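(* Let $d\ge2$, let $p_c<p<1$, and let $\mathbb{P}_p$ denote the site percolation measure on $\mathbb{Z}^d$ with parameter $p$. There exists a sequence $u_n(x)$ with $u_n(x)\in\mathbb{N}$ and $u_n(x)\to\infty$ as $n\to\infty$ for all $x\in\mathbb{R}$, such that for all $x\in\mathbb{R}$, $$\mathbb{P}_p(|C_{\max}|\le u_n(x))=e^{-e^{-x}}+o(1)\quad\text{as } n\to\infty,$$ where the error term may depend on $x$.
   Context: Site percolation: $\mathbb{P}_p$ is the Bernoulli product measure on $\{0,1\}^{\mathbb{Z}^d}$ with $\mathbb{P}_p(\omega(x)=1)=p$ and $\mathbb{P}_p(\omega(x)=0)=1-p$ for each $x\in\mathbb{Z}^d$. A site $x$ is occupied if $\omega(x)=1$. $C(x)$ is the set of occupied sites that can be connected to $x$ by a nearest-neighbour path in $\mathbb{Z}^d$ passing only through occupied sites; $C(x)=\varnothing$ if $\omega(x)\neq1$. $|X|$ is the number of sites of $X$. $p_c$ is the critical probability for site percolation on $\mathbb{Z}^d$, i.e. $p_c=\sup\{p:\mathbb{P}_p(|C(0)|=\infty)=0\}$. $B_n=[-n,n]^d\cap\mathbb{Z}^d$, and $|C_{\max}|=\max_{x\in B_n:\,|C(x)|<\infty}|C(x)|$ is the size of the largest finite cluster intersecting $B_n$ (it depends on $n$). *)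

(* Defs.v *)
From HB Require Import structures.
From mathcomp Require Import all_boot all_order all_algebra.
From mathcomp Require Import finmap zify ring lra.
From mathcomp Require Import all_classical all_reals all_analysis.
From mathcomp Require Import measurable_realfun.

Set Implicit Arguments.
Unset Strict Implicit.
Unset Printing Implicit Defensive.

Import Order.TTheory GRing.Theory Num.Theory.

Local Open Scope classical_set_scope.
Local Open Scope ring_scope.

(* The product sigma-algebra on {0,1}^V. *)
Definition site_events (V : Type) : set (set (V -> bool)) :=
  [set E | exists x : V, E = [set w : V -> bool | w x]].

Definition config (V : Type) : Type := g_sigma_algebraType (@site_events V).

HB.instance Definition _ (V : Type) := Measurable.on (config V).

(* P is the Bernoulli product measure with parameter p; existence and
   uniqueness are bernoulli_product_exists and bernoulli_product_unique. *)
Definition is_bernoulli_product (V : countType) (R : realType) (p : R)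
    (P : probability (config V) R) : Prop :=
  forall (A : {fset V}) (eta : V -> bool),
    P [set w : V -> bool | {in A, w =1 eta}] =
    (\prod_(x <- A) bernoulli_pmf p (eta x))%:E.

(* Existence: push Lebesgue measure on [0, 1[ forward along an expansion of
   u in which every digit is occupied with probability p. *)
Section bernoulli_product_existence.
Variables (V : countType) (R : realType) (p : R).

Definition digit_shift (u : R) : R :=
  if u < p then u / p else (u - p) / (1 - p).

Definition digit (n : nat) (u : R) : bool := iter n digit_shift u < p.

Definition digits (u : measurableTypeR R) : config V :=
  fun x : V => digit (choice.pickle x) u.

Lemma measurable_digit_shift :
  measurable_fun [set: measurableTypeR R] (digit_shift : _ -> measurableTypeR R).
Proof.
apply: measurable_fun_ifT.
- exact: measurable_fun_ltr.
- exact: measurable_funM.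
- by apply: measurable_funM => //; exact: measurable_funB.
Qed.

Lemma measurable_digit n :
  measurable_fun [set: measurableTypeR R] (digit n).
Proof.
apply: measurable_fun_ltr => //.
elim: n => [|n IHn] /=; first exact: measurable_id.
exact: (measurableT_comp measurable_digit_shift).
Qed.

Lemma measurable_digits : measurable_fun setT digits.
Proof.
apply: (@measurability _ _ _ (config V) setT digits (@site_events V)) => //.
move=> _ [_ [x ->] <-]; rewrite setTI.
have := @measurable_digit (choice.pickle x) measurableT [set true] I.
by rewrite setTI.
Qed.

Definition lebesgue01 : set (measurableTypeR R) -> \bar R :=
  mrestr (@lebesgue_measure R) (measurable_itv `[0, 1[).

HB.instance Definition _ := Measure.on lebesgue01.

Lemma lebesgue01_setT : lebesgue01 setT = 1%E.
Proof.
rewrite /lebesgue01 /mrestr setTI.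
by rewrite lebesgue_measure_itv /= lte_fin ltr01 -EFinB subr0.
Qed.

HB.instance Definition _ :=
  Measure_isProbability.Build _ _ _ lebesgue01 lebesgue01_setT.

HB.instance Definition _ :=
  isMeasurableFun.Build _ _ _ _ digits measurable_digits.

Definition digits_distribution : probability (config V) R :=
  distribution lebesgue01 digits.

Hypothesis p01 : 0 <= p <= 1.
Local Notation pmf := (@bernoulli_pmf R p).

Definition prefix_set (s : seq bool) : set R :=
  [set u | `[0, 1[%classic u /\
    forall i, (i < size s)%N -> digit i u = nth false s i].

Lemma digitS n u : digit n.+1 u = digit n (digit_shift u).
Proof. by rewrite /digit iterSr. Qed.

Lemma prefix_set_cons b s u : prefix_set (b :: s) u <->
  `[0, 1[%classic u /\ (u < p) = b /\ prefix_set s (digit_shift u).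
Proof.
move: p01 => /andP[p0 p1].
split=> [[u01 us]|[u01 [ub [_ us]]]].
  split=> //; split; first exact: (us 0%N).
  split; last by move=> i si; rewrite -digitS (us i.+1).
  move: u01; rewrite /= !in_itv /= => /andP[u0 u1].
  rewrite /digit_shift; case: ifPn => [up|].
    have p_gt0 : 0 < p by exact: le_lt_trans up.
    by rewrite divr_ge0// ltr_pdivrMr// mul1r.
  rewrite -leNgt => pu; have q_gt0 : 0 < 1 - p by lra.
  by rewrite divr_ge0 ?(ltW q_gt0)//= ?subr_ge0// ltr_pdivrMr// mul1r ltrD2r.
by split=> // -[_|i si] //; rewrite digitS us.
Qed.

Lemma prefix_set_itv s : exists a b,
  [/\ prefix_set s = `[a, b[%classic, 0 <= a, a <= b, b <= 1 &
      b - a = \prod_(c <- s) pmf c].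
Proof.
move: p01 => /andP[p0 p1].
elim: s => [|c s [a [b [sab a0 ab b1 ba]]]].
  exists 0, 1; split; rewrite ?big_nil ?subr0//.
  by apply/seteqP; split=> u //= [].
have shiftE u : prefix_set s (digit_shift u) <-> a <= digit_shift u < b.
  by rewrite sab /= in_itv.
case: c.
  exists (p * a), (p * b); split.
  - apply/seteqP; split => u /=.
    + rewrite prefix_set_cons shiftE /= !in_itv /= => -[/andP[u0 u1]] [up].
      have p_gt0 : 0 < p by exact: le_lt_trans up.
      rewrite /digit_shift up ler_pdivlMr// ltr_pdivrMr//.
      by rewrite ![p * _]mulrC.
    + rewrite in_itv /= => /andP[pau upb].
      have p_gt0 : 0 < p.
        rewrite lt_neqAle p0 andbT; apply/eqP => pE.
        by move: pau upb; rewrite -pE !mul0r => /le_lt_trans h /h; rewrite ltxx.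
      have up : u < p by rewrite (lt_le_trans upb)// ler_piMr.
      rewrite prefix_set_cons shiftE /= in_itv /= /digit_shift up.
      rewrite ler_pdivlMr// ltr_pdivrMr// ![_ * p]mulrC pau upb.
      by rewrite (le_trans _ pau) ?mulr_ge0// (lt_le_trans up).
  - exact: mulr_ge0.
  - exact: ler_wpM2l.
  - by rewrite mulr_ile1// (le_trans a0).
  - by rewrite big_cons -mulrBr ba.
exists (p + (1 - p) * a), (p + (1 - p) * b); split.
- apply/seteqP; split => u /=.
  + rewrite prefix_set_cons shiftE /= !in_itv /= => -[/andP[u0 u1]] [up].
    have pu : p <= u by rewrite leNgt up.
    have q_gt0 : 0 < 1 - p by lra.
    rewrite /digit_shift up ler_pdivlMr// ltr_pdivrMr//.
    by rewrite lerBrDl ltrBlDl ![_ * (1 - p)]mulrC.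
  + rewrite in_itv /= => /andP[pau upb].
    have q_gt0 : 0 < 1 - p.
      rewrite lt_neqAle subr_ge0 p1 andbT; apply/eqP => qE.
      by move: pau upb; rewrite -qE !mul0r => /le_lt_trans h /h; rewrite ltxx.
    have pu : p <= u by rewrite (le_trans _ pau)// lerDl mulr_ge0// ltW.
    have up : (u < p) = false by apply/negbTE; rewrite -leNgt.
    rewrite prefix_set_cons shiftE /= in_itv /= /digit_shift up.
    rewrite ler_pdivlMr// ltr_pdivrMr// lerBrDl ltrBlDl ![_ * (1 - p)]mulrC.
    rewrite pau upb (le_trans p0 pu) (lt_le_trans upb)//.
    by have := mulr_ge0 (ltW q_gt0) (_ : 0 <= 1 - b); rewrite subr_ge0 => /(_ b1); lra.
- by rewrite addr_ge0// mulr_ge0// subr_ge0.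
- by rewrite lerD2l ler_wpM2l// subr_ge0.
- by nra.
- by rewrite big_cons -ba /=; ring.
Qed.

Definition pattern_set (s : seq bool) (c : seq (option bool)) : set R :=
  prefix_set s `&` [set u | forall i b, onth c i = Some (Some b) ->
    digit (size s + i) u = b].

Lemma prefix_set_rcons s b :
  prefix_set (rcons s b) = prefix_set s `&` [set u | digit (size s) u = b].
Proof.
apply/seteqP; split => u /= [].
  move=> u01 us; split; last by rewrite us ?size_rcons// nth_rcons ltnn eqxx.
  split=> // i si; rewrite us ?size_rcons ?ltnS ?(ltnW si)//.
  by rewrite nth_rcons si.
move=> [u01 us] ub; split => // i; rewrite size_rcons ltnS leq_eqVlt nth_rcons.
case: ltngtP => //= [si _|->]; first exact: us.
by rewrite ub.
Qed.

Lemma pattern_set_Some s b c :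
  pattern_set s (Some b :: c) = pattern_set (rcons s b) c.
Proof.
rewrite /pattern_set prefix_set_rcons -setIA; congr (_ `&` _).
apply/seteqP; split => u /=.
  move=> h; split; first by have := h 0%N b erefl; rewrite addn0.
  by move=> i b' ci; rewrite size_rcons addSnnS (h i.+1 b').
move=> [h0 h] [|i] b' /=; first by case=> <-; rewrite addn0.
by move=> /h; rewrite size_rcons addSnnS.
Qed.

Lemma pattern_set_None s c : pattern_set s (None :: c) =
  pattern_set (rcons s true) c `|` pattern_set (rcons s false) c.
Proof.
rewrite /pattern_set !prefix_set_rcons !size_rcons; apply/seteqP; split => u /=.
  move=> [su h]; case E : (digit (size s) u); [left|right]; split=> // i b ci;
  by rewrite addSnnS (h i.+1 b).
by move=> [] [[su ub] h]; split=> // -[|i] b //= /h; rewrite addSnnS.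
Qed.

Definition weight (o : option bool) : R := if o is Some b then pmf b else 1.

Lemma lebesgue_pattern_set s c : measurable (pattern_set s c) /\
  @lebesgue_measure R (pattern_set s c) =
    ((\prod_(b <- s) pmf b) * \prod_(o <- c) weight o)%:E.
Proof.
elim: c s => [|[b|] c IHc] s.
- have -> : pattern_set s [::] = prefix_set s.
    by apply/seteqP; split => [u []|u su] //; split => // -[].
  have [a [b [-> a0 ab b1 ba]]] := prefix_set_itv s.
  split; first exact: measurable_itv.
  rewrite lebesgue_measure_itv /= lte_fin big_nil mulr1 -ba.
  by case: ltP => // bla; rewrite (le_anti (introT andP (conj ab bla))) subrr.
- rewrite pattern_set_Some; have [m ->] := IHc (rcons s b); split => //.
  by rewrite big_rcons big_cons /= mulrA.
- rewrite pattern_set_None.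
  have [mt Et] := IHc (rcons s true); have [mf Ef] := IHc (rcons s false).
  split; first exact: measurableU.
  rewrite measureU//; last first.
    rewrite /pattern_set !prefix_set_rcons -subset0 => u /=.
    by move=> [[[_ ->] _] [[_]]].
  rewrite [X in (X + _)%E]Et [X in (_ + X)%E]Ef -EFinD.
  rewrite !big_rcons big_cons /= /bernoulli_pmf.
  by congr EFin; ring.
Qed.

Lemma onth_iota m n i : (i < n)%N -> onth (iota m n) i = Some (m + i)%N.
Proof. by move=> iltn; rewrite onthE (nth_map 0%N) ?size_iota// nth_iota. Qed.

Lemma digits_distributionP (A : {fset V}) (eta : V -> bool) :
  digits_distribution [set w : V -> bool | {in A, w =1 eta}] =
  (\prod_(x <- A) pmf (eta x))%:E.
Proof.
pose N := (\max_(x <- A) (choice.pickle x).+1)%N.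
have ltN x : x \in A -> (choice.pickle x < N)%N.
  by move=> xA; rewrite /N (big_rem x)//= leq_maxl.
pose f i : option bool := if (pickle_inv i : option V) is Some x then
  if x \in A then Some (eta x) else None else None.
have fE x : x \in A -> f (choice.pickle x) = Some (eta x).
  by move=> xA; rewrite /f pickleK_inv xA.
have f_Some i b : f i = Some b ->
    exists2 x, x \in A & i = choice.pickle x /\ b = eta x.
  rewrite /f; case E : (pickle_inv i) => [x|//]; case: ifPn => // xA [<-].
  by exists x => //; split=> //; have := @pickle_invK V i; rewrite /oapp E.
rewrite /digits_distribution /= /distribution /pushforward /lebesgue01 /mrestr.
rewrite (_ : _ `&` _ = pattern_set [::] (mkseq f N)); last first.
  apply/seteqP; split => u /=.
    move=> [uA u01]; split; first by split.
    move=> i b; rewrite /= add0n onth_map.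
    case: (ltnP i N) => iN; last by rewrite onth_default// size_iota.
    rewrite (onth_iota _ iN) /= add0n => -[/f_Some[x xA [-> ->]]].
    exact: uA.
  move=> [[u01 _] h]; split => // x xA.
  rewrite /digits -[RHS](h (choice.pickle x) (eta x)) ?add0n//.
  by rewrite onth_map (onth_iota _ (ltN _ xA)) /= add0n fE.
have [_ ->] := lebesgue_pattern_set [::] (mkseq f N).
rewrite big_nil mul1r; congr EFin.
rewrite big_map (bigID (fun i => i \in [seq choice.pickle x | x <- A])) /=.
rewrite [X in _ * X]big1_seq ?mulr1; last first.
  move=> i /andP[iA _]; case E : (f i) => [b|//].
  by have [x xA [ix _]] := f_Some _ _ E; rewrite ix map_f in iA.
rewrite -big_filter (perm_big [seq choice.pickle x | x <- A]).
  by rewrite big_map; apply: eq_big_seq => x xA; rewrite fE.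
apply: uniq_perm; first by rewrite filter_uniq// iota_uniq.
  by rewrite (map_inj_uniq (pcan_inj choice.pickleK)) fset_uniq.
move=> i; rewrite mem_filter mem_iota /= add0n.
by case: mapP => // -[x xA ->]; rewrite ltN.
Qed.

End bernoulli_product_existence.

Lemma bernoulli_product_exists (V : countType) (R : realType) (p : R) :
  0 <= p <= 1 ->
  exists P : probability (config V) R, is_bernoulli_product p P.
Proof.
move=> p01; exists (digits_distribution V p) => A eta.
exact: digits_distributionP.
Qed.

Section bernoulli_product_uniqueness.
Variables (V : countType) (R : realType) (p : R).

Definition cylinder (A : {fset V}) (eta : V -> bool) : set (config V) :=
  [set w : V -> bool | {in A, w =1 eta}].

Lemma measurable_site (x : V) :
  measurable ([set w : V -> bool | w x] : set (config V)).
Proof. by apply: sub_sigma_algebra; exists x. Qed.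

Lemma measurable_cylinder A eta : measurable (cylinder A eta).
Proof.
have -> : cylinder A eta = \bigcap_(x in [set` A])
    (if eta x then [set w : V -> bool | w x] else ~` [set w : V -> bool | w x]).
  apply/seteqP; split => w /= wA x xA; have := wA x xA; case: (eta x) => //=.
  - by move=> ->.
  - by move=> /negP/negbTE.
apply: fin_bigcap_measurable => // x _; case: (eta x).
  exact: measurable_site.
by apply: measurableC; exact: measurable_site.
Qed.

Lemma bernoulli_product_unique (P Q : probability (config V) R) :
  is_bernoulli_product p P -> is_bernoulli_product p Q ->
  forall E, measurable E -> P E = Q E.
Proof.
move=> HP HQ.
pose G : set (set (config V)) :=
  [set E | E = set0 \/ exists A eta, E = cylinder A eta].
have sub E : measurable E -> <<s G >> E.
  apply: smallest_sub; first exact: smallest_sigma_algebra.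
  move=> _ [x ->]; apply: sub_sigma_algebra; right.
  exists [fset x]%fset, (fun=> true); apply/seteqP; split => w /=.
    by move=> wx y /fset1P ->.
  by move=> /(_ x); apply; rewrite inE.
move=> E /sub; apply: (@g_sigma_algebra_measure_unique _ _ _ G _ (fun=> setT)).
- by move=> _ [->|[A [eta ->]]]; [exact: measurable0|exact: measurable_cylinder].
- move=> _; right; exists fset0, (fun=> true).
  by apply/seteqP; split => // w _ x; rewrite inE.
- by apply/seteqP; split => // w _; exists 0%N.
- move=> X Y [->|[A [eta ->]]]; first by rewrite set0I; left.
  move=> [->|[B [zeta ->]]]; first by rewrite setI0; left.
  have [AB|/existsNP[x /not_implyP[xA /not_implyP[xB exz]]]] :=
    pselect (forall x, x \in A -> x \in B -> eta x = zeta x); last first.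
    left; rewrite -subset0 => w [/(_ x xA) wx /(_ x xB)].
    by rewrite wx.
  right; exists (A `|` B)%fset, (fun x => if x \in A then eta x else zeta x).
  apply/seteqP; split => w /=.
    move=> [wA wB] x; rewrite inE => /orP[xA|xB]; first by rewrite xA wA.
    by case: ifPn => xA; [exact: wA|exact: wB].
  move=> wAB; split=> x xA; first by rewrite wAB ?inE ?xA.
  by rewrite wAB ?inE ?xA ?orbT//; case: ifPn => // xA'; rewrite AB.
- move=> _ [->|[A [eta ->]]]; first by rewrite !measure0.
  by transitivity (\prod_(x <- A) bernoulli_pmf p (eta x))%:E;
    [exact: HP|exact/esym/HQ].
- by move=> _; rewrite -ge0_fin_numE ?fin_num_measure.
Qed.

End bernoulli_product_uniqueness.

Section percolation.
Variables (d : nat) (R : realType).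

Definition site : countType := 'rV[int]_d.

(* The default of xget is irrelevant when 0 <= p <= 1. *)
Definition percolation_measure (p : R) : probability (config site) R :=
  xget (digits_distribution site p) [set P | is_bernoulli_product p P].

Lemma percolation_measureP (p : R) :
  0 <= p <= 1 -> is_bernoulli_product p (percolation_measure p).
Proof.
move=> /(bernoulli_product_exists site)[P HP].
exact: (@xgetPex _ _ [set P | is_bernoulli_product p P] (ex_intro _ P HP)).
Qed.

Definition adjacent (x y : 'rV[int]_d) : bool :=
  \sum_(i < d) `|x 0 i - y 0 i| == 1.

Definition cluster (w : 'rV[int]_d -> bool) (x : 'rV[int]_d) : set 'rV[int]_d :=
  [set y | exists2 s : seq 'rV[int]_d,
    path adjacent x s /\ last x s = y & all w (x :: s)].

Definition critical_probability : R :=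
  sup [set p : R | 0 <= p <= 1 /\
    percolation_measure p
      [set w : 'rV[int]_d -> bool | infinite_set (cluster w 0)] = 0%E].

Definition box (n : nat) : set 'rV[int]_d :=
  [set x | forall i, - (n%:Z) <= x 0 i <= n%:Z].

Lemma finite_box n : finite_set (box n).
Proof.
pose f (g : {ffun 'I_d -> 'I_(n + n).+1}) : 'rV[int]_d :=
  \row_i ((g i : nat)%:Z - n%:Z).
apply: (@sub_finite_set _ _ (f @` setT)); last exact: finite_image.
move=> x xn /=; exists [ffun i => inord `|(x 0 i + n%:Z)%R|%N] => //.
apply/rowP => i; rewrite !mxE ffunE inordK; first by have := xn i; lia.
by have := xn i; lia.
Qed.

(* The maximum over no finite cluster at all is 0. *)
Definition Cmax (n : nat) (w : 'rV[int]_d -> bool) : nat :=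
  \max_(x <- fset_set (box n) | `[< finite_set (cluster w x) >])
    #|` fset_set (cluster w x)|.

Lemma measurable_in_cluster x y :
  measurable ([set w : site -> bool | cluster w x y] : set (config site)).
Proof.
rewrite (_ : [set w : site -> bool | _] = \bigcup_(s : seq site)
    (if path adjacent x s && (last x s == y)
     then cylinder [fset z in x :: s]%fset (fun=> true) else set0)).
  apply: countable_bigcupT_measurable => // s.
  by case: ifP => _; [exact: measurable_cylinder|exact: measurable0].
apply/seteqP; split => [w [s [ps ls] ws]|w [s _]].
  exists s => //; rewrite ps ls eqxx => z; rewrite in_fset => zs.
  by apply: (allP ws).
case: ifP => // /andP[ps /eqP ls] ws; exists s => //; apply/allP => z zs.
by rewrite ws// in_fset.
Qed.

Lemma measurable_cluster_eq x (S : {fset site}) :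
  measurable ([set w : site -> bool | cluster w x = [set` S]] :
    set (config site)).
Proof.
rewrite (_ : [set w : site -> bool | _] = ~` \bigcup_(y : site)
    (if y \in S then ~` [set w : site -> bool | cluster w x y]
     else [set w : site -> bool | cluster w x y])).
  apply: measurableC; apply: countable_bigcupT_measurable => // y.
  case: ifP => _; last exact: measurable_in_cluster.
  by apply: measurableC; exact: measurable_in_cluster.
apply/seteqP; split => w /=.
  by move=> E [y _]; case: ifP => /= yS; rewrite /setC /= E /= yS.
move=> H; apply/seteqP; split => y /=.
  by move=> cy; apply: contrapT => /negP/negbTE yS; apply: H; exists y; rewrite ?yS.
by move=> yS; apply: contrapT => cy; apply: H; exists y; rewrite ?yS.
Qed.

Lemma measurable_finite_cluster x :
  measurable ([set w : site -> bool | finite_set (cluster w x)] :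
    set (config site)).
Proof.
rewrite (_ : [set w : site -> bool | _] = \bigcup_(S : {fset site})
    [set w : site -> bool | cluster w x = [set` S]]).
  by apply: countable_bigcupT_measurable => // S; exact: measurable_cluster_eq.
apply/seteqP; split => [w /= /finite_fsetP[S ES]|w [S _ ES]]; first by exists S.
by apply/finite_fsetP; exists S.
Qed.

Lemma measurable_infinite_cluster x :
  measurable ([set w : site -> bool | infinite_set (cluster w x)] :
    set (config site)).
Proof. by apply: measurableC; exact: measurable_finite_cluster. Qed.

Lemma measurable_Cmax_le n k :
  measurable ([set w : site -> bool | (Cmax n w <= k)%N] : set (config site)).
Proof.
rewrite (_ : [set w : site -> bool | _] = \bigcap_(x in box n)
    ([set w : site -> bool | infinite_set (cluster w x)] `|`
     \bigcup_(S : {fset site}) (if (#|` S| <= k)%N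
       then [set w : site -> bool | cluster w x = [set` S]] else set0))).
  apply: fin_bigcap_measurable => [|x _]; first exact: finite_box.
  apply: measurableU; first exact: measurable_infinite_cluster.
  apply: countable_bigcupT_measurable => // S.
  by case: ifP => _; [exact: measurable_cluster_eq|exact: measurable0].
apply/seteqP; split => w /=.
  move=> /bigmax_leqP_seq wk x xn.
  have [/[dup] fx /finite_fsetP[S ES]|] := pselect (finite_set (cluster w x));
    last by left.
  right; exists S => //; have := wk x; rewrite ES set_fsetK in_fset_set ?mem_set//;
    last exact: finite_box.
  by move=> ->//; apply/asboolP; rewrite -ES.
move=> wk; apply/bigmax_leqP_seq => x.
rewrite in_fset_set; last exact: finite_box.
move=> /set_mem/wk [inf /asboolP//|[S _]].
by case: ifP => // Sk /= -> _; rewrite set_fsetK.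
Qed.

End percolation.

(* Main.v *)
Require Import Defs.
From HB Require Import structures.
From mathcomp Require Import all_boot all_order all_algebra.
From mathcomp Require Import finmap zify ring lra.
From mathcomp Require Import all_classical all_reals all_analysis.
From mathcomp Require Import measurable_realfun.
Import Defs.

Set Implicit Arguments.
Unset Strict Implicit.
Unset Printing Implicit Defensive.

Import Order.TTheory GRing.Theory Num.Theory.

Local Open Scope classical_set_scope.
Local Open Scope ring_scope.

(** Let M_n be the size of the largest finite cluster meeting the box of
    half-width n. With q = exp (- exp (- x)), the natural choice of u_n(x) is
    the q-quantile of M_n, that is, the least k with P(M_n <= k) >= q. Then
    P(M_n <= u_n) exceeds q by at most P(M_n = u_n), so what has to be shown is
    that the law of M_n puts asymptotically no mass on the point u_n, and that
    u_n tends to infinity. No limit law for M_n is needed, only two estimates.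

    M_n is larger than any multiple of log n ([pr_Cmax_log_small]). This is
    where p > p_c enters. A site of a box of side L is connected inside the box
    to its boundary with probability at least theta = P(|C(0)| = oo) > 0, so
    that, with probability at least theta / 2, at least (theta / 2) L^d sites
    are. An occupied shell around the box joins all of them into one cluster,
    and a vacant shell around the first makes that cluster finite. The two
    shells cost a factor exp (- O(L^(d-1))), whereas the cluster has order L^d
    sites. Hence a cluster of C log n sites is produced with probability
    n^(- o(1)) in a given box, and one of the disjoint translates of the box
    along an axis succeeds with high probability.

    Beyond a large multiple of log n, the law of M_n has no large atoms
    ([pr_Cmax_eq_le], [pr_Cmax_atom_small]). Cut the lattice into blocks of
    side 3. Call a block good for a cluster A when A contains all its sites
    except possibly the central one, and filled when A contains the centre too.
    As d >= 2, the block minus its centre is connected, so that changing the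
    state of the centre of a good block changes the size of A by one and
    affects nothing else. Given all the rest, the number j of filled blocks
    among the m good ones is thus binomial (m, p), and its weight at j exceeds
    its weight at j + 1 by at most a factor close to 1 as long as j < a m with a
    slightly above p. Therefore the event that the largest cluster has k sites is hardly
    more likely than each of the T disjoint events that the largest cluster has
    k + t sites, t = 1, ..., T, and all others at most k: its probability is at
    most 2 / T ([typical_mass0_le]).

    This leaves out the clusters for which j is larger than a m - eta |S|, where
    S is the set of blocks meeting the cluster or its boundary. These are
    exponentially rare in |S| ([unbalanced_sum_le]), by a change of measure
    that acts on whole blocks: since the event that the cluster of x is A
    depends on the blocks of S only, weighting every block by
    exp (tilt * score) / Z, where Z < 1 is the mean of the exponential,
    multiplies its probability by at least Z^(- |S|) when A is one of them, and
    the new probabilities still add up to at most 1. Summing Z^|S| over the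
    starting points in the box costs a factor of order n^d, which is harmless
    since the size is a large multiple of log n. *)

(** * Independence and translation invariance of the product measure *)

Lemma measurable_fun_config d (T : measurableType d) (V : Type)
    (f : T -> config V) :
  (forall x, measurable [set t | f t x]) -> measurable_fun setT f.
Proof.
move=> mf; apply: (@measurability _ _ _ (config V) setT f (@site_events V)) => //.
by move=> _ [_ [x ->] <-]; rewrite setTI; exact: mf.
Qed.

Section product_measure.
Variables (V : countType) (R : realType) (p : R) (P : probability (config V) R).
Hypothesis HP : is_bernoulli_product p P.

Definition depends_on (U : pred V) (E : set (config V)) :=
  forall w w' : V -> bool, {in U, w =1 w'} -> E w -> E w'.

(** Resampling the sites of [U] from an independent copy of the configuration. *)
Definition merge (U : pred V) (ww : config V * config V) : config V :=
  fun x => if U x then ww.2 x else ww.1 x.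

Lemma measurable_merge U : measurable_fun setT (merge U).
Proof.
apply: measurable_fun_config => x; rewrite /merge.
case: (U x).
  have := @measurable_snd _ _ (config V) (config V) measurableT _ (measurable_site x).
  by rewrite setTI.
have := @measurable_fst _ _ (config V) (config V) measurableT _ (measurable_site x).
by rewrite setTI.
Qed.

HB.instance Definition _ U :=
  isMeasurableFun.Build _ _ _ _ (merge U) (measurable_merge U).

(** The configuration equal to one sample on [U] and to an independent sample
    elsewhere has again the product law, by uniqueness of that law. Under this
    representation the two events concern different samples. *)
Lemma independence (U : pred V) (E F : set (config V)) :
  measurable E -> measurable F -> depends_on U E -> depends_on (predC U) F ->
  P (E `&` F) = (P E * P F)%E.
Proof.
move=> mE mF dE dF.
pose Q : probability (config V) R := distribution (P \x P)%E (merge U).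
have QE B : Q B = (P \x P)%E (merge U @^-1` B) by [].
have HQ : is_bernoulli_product p Q.
  move=> A eta; rewrite QE.
  rewrite (_ : _ @^-1` _ = cylinder [fset x in A | ~~ U x]%fset eta `*`
                          cylinder [fset x in A | U x]%fset eta); last first.
    apply/seteqP; split=> [[w w'] h|[w w'] [/= h1 h2] x xA].
      split => x; rewrite !inE /= => /andP[xA Ux]; have := h x xA; rewrite /merge.
        by rewrite (negbTE Ux).
      by rewrite Ux.
    rewrite /merge /=; case: ifPn => Ux; [apply: h2|apply: h1];
    by rewrite !inE /= xA.
  rewrite product_measure1E; [|exact: measurable_cylinder|exact: measurable_cylinder].
  transitivity
    ((\prod_(x <- [fset x in A | ~~ U x]%fset) bernoulli_pmf p (eta x))%:E *
     (\prod_(x <- [fset x in A | U x]%fset) bernoulli_pmf p (eta x))%:E)%E.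
    by congr (_ * _)%E; exact: HP.
  rewrite -EFinM; congr EFin.
  rewrite [RHS](bigID U) /= mulrC !big_fset /=.
  by congr (_ * _); apply: eq_bigl => x; rewrite ?andbT.
rewrite (bernoulli_product_unique HP HQ); last exact: measurableI.
rewrite QE (_ : _ @^-1` _ = F `*` E).
  by rewrite product_measure1E// muleC.
apply/seteqP; split => [[w w'] [/= hE hF]|[w w'] [/= hF hE]].
  split => /=.
    by apply: dF hF => x; rewrite inE /= /merge => /negbTE->.
  by apply: (dE _ _ _ hE) => x; rewrite /merge -topredE /= => ->.
split => /=.
  by apply: (dE _ _ _ hE) => x; rewrite /merge -topredE /= => ->.
by apply: dF hF => x; rewrite inE /= /merge => /negbTE->.
Qed.

(** The coordinates read along an injection are again independent with the same
    law. Applied to translations of the lattice. *)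
Lemma bernoulli_product_reindex (s : V -> V) (E : set (config V)) :
  injective s -> measurable E ->
  P [set w : V -> bool | E (w \o s)] = P E.
Proof.
move=> sinj mE.
have ms : measurable_fun setT (fun w : config V => (w \o s) : config V).
  by apply: measurable_fun_config => x; exact: measurable_site.
pose f : {mfun config V >-> config V} := HB.pack
  (fun w : config V => (w \o s) : config V) (isMeasurableFun.Build _ _ _ _ _ ms).
pose Q : probability (config V) R := distribution P f.
have QE B : Q B = P [set w : V -> bool | B (w \o s)] by [].
have HQ : is_bernoulli_product p Q.
  move=> A eta; rewrite QE.
  pose eta' := fun y => [exists x : A, (s (val x) == y) && eta (val x)].
  have etaE x : x \in A -> eta' (s x) = eta x.
    move=> xA; apply/existsP/idP => [[y /andP[/eqP/sinj-> //]]|ex].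
    by exists [`xA]%fset => /=; rewrite eqxx.
  rewrite (_ : [set _ | _] = cylinder (s @` A)%fset eta'); last first.
    apply/seteqP; split => w /= h.
      by move=> _ /imfsetP[x /= xA ->]; rewrite etaE// -h.
    by move=> x xA; rewrite -etaE// -[LHS]/(w (s x)) h// in_imfset.
  rewrite [LHS]HP; congr EFin; rewrite big_imfset /=; last by move=> x y _ _ /sinj.
  rewrite big_seq_cond [RHS]big_seq_cond; apply: eq_bigr => x.
  by rewrite andbT => /etaE->.
by rewrite (bernoulli_product_unique HP HQ mE) QE.
Qed.

Lemma measurable_local (U : {fset V}) (E : set (config V)) :
  depends_on (mem U) E -> measurable E.
Proof.
move=> dE.
rewrite (_ : E = \bigcup_(B : {fset V})
   (if `[< E (fun x => x \in B) >] then cylinder U (fun x => x \in B) else set0)).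
  apply: countable_bigcupT_measurable => // B.
  by case: ifP => _; [exact: measurable_cylinder|exact: measurable0].
apply/seteqP; split => [w Ew|w [B _]].
  have h : {in U, w =1 (fun x => x \in [fset x in U | w x]%fset)}.
    by move=> x xU; rewrite !inE /= xU.
  exists [fset x in U | w x]%fset => //; case: asboolP => [_ //|[]].
  exact: dE Ew.
by case: asboolP => // EB wB; apply: dE EB => x /wB.
Qed.

End product_measure.

(** * Real-valued probabilities *)

Section real_valued_probability.
Context {dT : measure_display} {T : measurableType dT} {R : realType}.
Variable P : probability T R.

Definition pr (E : set T) : R := fine (P E).

Lemma prE E : measurable E -> P E = (pr E)%:E.
Proof. by move=> mE; rewrite /pr fineK// fin_num_measure. Qed.

Lemma pr_ge0 E : 0 <= pr E.
Proof. exact: fine_ge0. Qed.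

Lemma pr_le1 E : measurable E -> pr E <= 1.
Proof. by move=> mE; rewrite -lee_fin -prE// probability_le1. Qed.

Lemma le_pr E F : measurable E -> measurable F -> E `<=` F -> pr E <= pr F.
Proof. by move=> mE mF EF; rewrite -lee_fin -!prE// le_measure// inE. Qed.

Lemma pr_setC E : measurable E -> pr (~` E) = 1 - pr E.
Proof.
move=> mE; have := probability_setC P mE.
by rewrite (prE mE) (prE (measurableC mE)) -EFinB => -[].
Qed.

Lemma pr_setU_le E F : measurable E -> measurable F ->
  pr (E `|` F) <= pr E + pr F.
Proof.
move=> mE mF; rewrite -lee_fin EFinD -!prE//; last exact: measurableU.
exact: measureU2.
Qed.

Lemma pr_union_bound (I : eqType) (s : seq I) (F : I -> set T) (E : set T) :
  measurable E -> (forall i, i \in s -> measurable (F i)) ->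
  (forall w, E w -> exists2 i, i \in s & F i w) ->
  pr E <= \sum_(i <- s) pr (F i).
Proof.
elim: s E => [|i s IHs] E mE mF EF.
  rewrite big_nil (_ : E = set0) ?/pr ?measure0//.
  by rewrite -subset0 => w /EF[].
have mFi : measurable (F i) by apply: mF; rewrite inE eqxx.
rewrite big_cons; apply: (@le_trans _ _ (pr (F i) + pr (E `\` F i))).
  rewrite (le_trans _ (pr_setU_le _ _))//; last exact: measurableD.
  apply: le_pr => //; first by apply: measurableU => //; exact: measurableD.
  by move=> w Ew; have [] := pselect (F i w); [left|right].
rewrite lerD2l; apply: IHs.
- exact: measurableD.
- by move=> j js; apply: mF; rewrite inE js orbT.
- move=> w [/EF[j]]; rewrite inE => /orP[/eqP->//|js Fj _]; by exists j.
Qed.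

(** The sum of the probabilities is the mean number of the events that occur.
    For [m = 1] the events are pairwise disjoint. *)
Lemma pr_sum_overlap_le (I : eqType) (s : seq I) (F : I -> set T) (m : nat) :
  (forall i, i \in s -> measurable (F i)) ->
  (forall w, (count (fun i => `[< F i w >]) s <= m)%N) ->
  \sum_(i <- s) pr (F i) <= m%:R.
Proof.
move=> mF Fm.
rewrite -lee_fin -sumEFin.
have -> : (\sum_(i <- s) (pr (F i))%:E =
    \sum_(i <- s) \int[P]_w ((\1_(if i \in s then F i else set0) w : R)%:E))%E.
  rewrite [LHS]big_seq [RHS]big_seq; apply: eq_bigr => i is_; rewrite is_.
  by rewrite integral_indic// ?setIT -?prE//; exact: mF.
rewrite -(@ge0_integral_sum _ _ _ P setT measurableT _
  (fun i w => (\1_(if i \in s then F i else set0) w : R)%:E)).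
apply: (@le_trans _ _ (\int[P]_w (m%:R : R)%:E)%E).
  apply: ge0_le_integral => //.
  - by move=> w _; apply: sume_ge0 => i _; rewrite lee_fin.
  - apply: emeasurable_sum => i; apply/measurable_EFinP; apply: measurable_indic.
    by case: ifP => // /mF.
  - move=> w _; rewrite sumEFin lee_fin.
    apply: le_trans (_ : (count (fun i => `[< F i w >]) s)%:R <= _); last first.
      by rewrite ler_nat.
    rewrite -sum1_count natr_sum [leRHS]big_mkcond /= big_seq [leRHS]big_seq.
    apply: ler_sum => i ->; rewrite indicE.
    by case: asboolP => /= Fi; [rewrite mem_set|rewrite memNset].
  by rewrite integral_cst//= probability_setT mule1.
- move=> i; apply/measurable_EFinP; apply: measurable_indic.
  by case: ifP => // /mF.
- by move=> i w _; rewrite lee_fin.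
Qed.

Lemma pr_bigcup_le (F : nat -> set T) (c : R) :
  (forall N, measurable (F N)) -> (forall N, F N `<=` F N.+1) ->
  (forall N, pr (F N) <= c) -> pr (\bigcup_N F N) <= c.
Proof.
move=> mF Fmono Fc.
have mU : measurable (\bigcup_N F N) by exact: bigcupT_measurable.
have : P \o F @ \oo --> P (\bigcup_N F N).
  apply: nondecreasing_cvg_mu => //.
  apply/nondecreasing_seqP => n; apply/subsetPset; exact: Fmono.
move=> /cvg_lim PF; rewrite -lee_fin -prE// -PF//.
apply: lime_le; first by apply/cvg_ex; eexists; apply: nondecreasing_cvg_mu => //;
   apply/nondecreasing_seqP => n; apply/subsetPset; exact: Fmono.
by apply: nearW => N /=; rewrite prE// lee_fin.
Qed.

End real_valued_probability.

(** * Shells of the lattice *)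

Section lattice.
Variable d : nat.
Implicit Types (x y z : 'rV[int]_d).

Definition sup_norm x : nat := \max_(i < d) `|x 0%R i|%N.

Lemma sup_norm_leP x n :
  reflect (forall i, (`|x 0%R i| <= n)%N) (sup_norm x <= n)%N.
Proof.
by rewrite /sup_norm; apply: (iffP (bigmax_leqP _ _ _)) => h i //; exact: h.
Qed.

Lemma le_sup_norm x i : (`|x 0%R i| <= sup_norm x)%N.
Proof. exact: (leq_bigmax i). Qed.

Lemma boxE n x : box n x <-> (sup_norm x <= n)%N.
Proof.
split=> [h|/sup_norm_leP h i]; last by have := h i; lia.
by apply/sup_norm_leP => i; have := h i; lia.
Qed.

Lemma sup_norm_eq x i n : (forall j, (`|x 0%R j| <= n)%N) -> `|x 0%R i|%N = n ->
  sup_norm x = n.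
Proof.
move=> h e; apply/eqP; rewrite eqn_leq; apply/andP; split.
  exact/sup_norm_leP.
by rewrite -e le_sup_norm.
Qed.

Lemma sup_norm_attained x : (0 < d)%N -> exists i, `|x 0%R i|%N = sup_norm x.
Proof.
move=> d0; have /bigop.eq_bigmax h : (0 < #|'I_d|)%N by rewrite card_ord.
by have [i ei] := h (fun i => `|x 0%R i|%N); exists i.
Qed.

Lemma adjacentC x y : adjacent x y = adjacent y x.
Proof. by rewrite /adjacent; under eq_bigr do rewrite distrC. Qed.

Lemma adjacent_le1 x y i : adjacent x y -> (`|(x 0 i - y 0 i)%R| <= 1)%N.
Proof.
move=> /eqP; rewrite (bigD1 i)//= => e.
have : (0 : int) <= \sum_(i0 < d | i0 != i) `|x 0 i0 - y 0 i0| by exact: sumr_ge0.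
by move: e; set S := \sum_(_ < d | _) _; lia.
Qed.

Lemma adjacent_neq x y : adjacent x y -> x != y.
Proof.
move=> xy; apply/eqP => e; move: xy; rewrite e /adjacent big1 // => i _.
by rewrite subrr normr0.
Qed.

Lemma adjacentDr x y z : adjacent (x + z) (y + z) = adjacent x y.
Proof.
rewrite /adjacent; congr (_ == _); apply: eq_bigr => i _; rewrite !mxE.
by congr `| _ |; ring.
Qed.

Lemma sup_norm_adjacent x y : adjacent x y -> (sup_norm y <= (sup_norm x).+1)%N.
Proof.
move=> xy; apply/sup_norm_leP => i.
by have := adjacent_le1 i xy; have := le_sup_norm x i; lia.
Qed.

Definition upd x i (a : int) : 'rV[int]_d := \row_j (if j == i then a else x 0 j).

Lemma adjacent_upd x i a : `|x 0 i - a| = 1 -> adjacent x (upd x i a).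
Proof.
move=> e; rewrite /adjacent (bigD1 i)//= mxE eqxx e big1 ?addr0// => j /negbTE ji.
by rewrite mxE ji subrr normr0.
Qed.

Section shell.
Variables (M : nat) (B : 'rV[int]_d -> Prop).
Hypothesis clB : forall y z, sup_norm y = M -> sup_norm z = M -> adjacent y z ->
  B y -> B z.

(** Moving along an axis other than [i] keeps the [i]-th coordinate extremal,
    hence stays in the shell. *)
Lemma shell_line x i j a : i != j -> sup_norm x = M -> `|x 0%R i|%N = M ->
  (`|a| <= M)%N -> B x -> B (upd x j a).
Proof.
move=> ij xM xiM aM.
have [n] : exists n : nat, (n = `|(x 0 j - a)%R|)%N by eexists.
elim: n x xM xiM => [|n IHn] x xM xiM e Bx.
  rewrite (_ : upd x j a = x)//; apply/rowP => k; rewrite mxE.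
  by case: eqP => // ->; lia.
pose b := if a < x 0 j then x 0 j - 1 else x 0 j + 1.
have bj : (`|(b - a)%R| = n)%N by rewrite /b; case: ifP => h; lia.
have xb : `|x 0 j - b| = 1 by rewrite /b; case: ifP => h; lia.
have bM : (`|b| <= M)%N.
  by have := le_sup_norm x j; rewrite xM /b; case: ifP => h; lia.
have uM : sup_norm (upd x j b) = M.
  apply: (@sup_norm_eq _ i); last by rewrite mxE (negbTE ij).
  by move=> k; rewrite mxE; case: ifP => // _; rewrite -xM le_sup_norm.
rewrite (_ : upd x j a = upd (upd x j b) j a); last first.
  by apply/rowP => k; rewrite !mxE; case: ifP.
apply: IHn => //.
- by rewrite mxE (negbTE ij).
- by rewrite mxE eqxx bj.
- by apply: clB Bx => //; exact: adjacent_upd.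
Qed.

(** One coordinate of [x] is extremal. Keeping it fixed, all the others can be
    moved to [M]; as there is another one, the first can then be moved too. *)
Lemma shell_to_corner x : (2 <= d)%N -> sup_norm x = M -> B x ->
  B (const_mx M%:Z).
Proof.
move=> d2 xM Bx.
have [i xi] := sup_norm_attained x (ltnW d2).
pose u (s : seq 'I_d) : 'rV[int]_d :=
  \row_j (if j \in s then M%:Z else x 0 j).
have uM s : i \notin s -> sup_norm (u s) = M.
  move=> is_; apply: (@sup_norm_eq _ i) => [k|]; rewrite mxE.
    by case: ifP => // _; rewrite -xM le_sup_norm.
  by rewrite (negbTE is_) xi.
have Bu s : i \notin s -> B (u s).
  elim: s => [|j s IHs].
    by rewrite (_ : u [::] = x)//; apply/rowP => k; rewrite mxE.
  rewrite inE negb_or => /andP[ij is_].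
  rewrite (_ : u (j :: s) = upd (u s) j M%:Z); last first.
    by apply/rowP => k; rewrite !mxE inE; case: eqP.
  by apply: (@shell_line _ i) => //;
    rewrite ?uM ?mxE ?(negbTE is_) ?xi//; apply: IHs.
pose t := [seq j <- enum 'I_d | j != i].
have it : i \notin t by rewrite mem_filter eqxx.
have [j ji] : exists j : 'I_d, j != i.
  have d1 : (1 < #|'I_d|)%N by rewrite card_ord.
  have /card_gt0P[j] : (0 < #|predC1 i|)%N by rewrite cardC1 -ltnS prednK// ltnW.
  by rewrite inE => ji; exists j.
rewrite (_ : const_mx _ = upd (u t) i M%:Z); last first.
  apply/rowP => k; rewrite !mxE; case: eqP => // /eqP ki.
  by rewrite mem_filter ki mem_enum.
apply: (@shell_line _ j) => //.
- exact: uM.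
- by rewrite mxE mem_filter ji mem_enum.
- exact: Bu.
Qed.
End shell.

(** Every site of the shell is joined to the corner. The hypothesis on [B] is
    one-sided, but adjacency is symmetric, so the complement of [B] satisfies
    it as well; this gives the way back from the corner. *)
Lemma shell_connected (M : nat) (B : 'rV[int]_d -> Prop) x z :
  (2 <= d)%N ->
  (forall y z, sup_norm y = M -> sup_norm z = M -> adjacent y z -> B y -> B z) ->
  sup_norm x = M -> sup_norm z = M -> B x -> B z.
Proof.
move=> d2 clB xM zM Bx; apply: contrapT => nBz.
apply: (@shell_to_corner M (fun y => ~ B y) _ z) => //.
  by move=> a b aM bM ab nBa Bb; apply: nBa; apply: clB Bb => //; rewrite adjacentC.
exact: (@shell_to_corner M B _ x).
Qed.

End lattice.

(** * Clusters and their boundaries *)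

Section clusters.
Variable d : nat.
Implicit Types (x y z : 'rV[int]_d) (w : 'rV[int]_d -> bool).

Lemma cluster_refl w x : w x -> cluster w x x.
Proof. by move=> wx; exists [::] => //=; rewrite wx. Qed.

Lemma cluster_step w x y z : cluster w x y -> adjacent y z -> w z -> cluster w x z.
Proof.
move=> [s [ps ls] ws] yz wz; exists (rcons s z).
  by rewrite rcons_path last_rcons ps ls yz.
by rewrite -rcons_cons all_rcons wz.
Qed.

(** With [cluster_refl] and [cluster_step], this characterizes the cluster as
    the least set containing [x] and stable under occupied steps; paths do not
    appear any more after this point. *)
Lemma cluster_ind w x (B : 'rV[int]_d -> Prop) : B x ->
  (forall y z, B y -> w y -> w z -> adjacent y z -> B z) ->
  forall y, cluster w x y -> B y.
Proof.
move=> Bx clB y [s []]; elim: s x Bx => [|z s IHs] x Bx /=; first by move=> _ <-.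
move=> /andP[xz ps] ls /and3P[wx wz ws]; apply: (IHs z) => //.
  exact: clB xz.
by rewrite /= wz.
Qed.

Lemma cluster_source w x y : cluster w x y -> w x.
Proof. by move=> [s _ /=/andP[]]. Qed.

Lemma cluster_occupied w x y : cluster w x y -> w y.
Proof.
move=> xy; apply: (@cluster_ind w x (fun z => w z)) (xy) => //.
exact: cluster_source xy.
Qed.

Lemma cluster_trans w x y z : cluster w x y -> cluster w y z -> cluster w x z.
Proof.
move=> xy; apply: (@cluster_ind w y (cluster w x)) => // a b xa _ wb ab.
exact: cluster_step xa ab wb.
Qed.

Lemma cluster_sym w x y : cluster w x y -> cluster w y x.
Proof.
move=> xy; apply: (@cluster_ind w x (fun z => cluster w z x)) (xy).
  exact: cluster_refl (cluster_source xy).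
move=> a b ax wa wb ab; apply: cluster_trans ax.
by apply: (@cluster_step _ _ b) => //; [exact: cluster_refl|rewrite adjacentC].
Qed.

Lemma cluster_mono w w' x : (forall z, w z -> w' z) -> cluster w x `<=` cluster w' x.
Proof.
move=> ww' y xy; apply: (@cluster_ind w x (cluster w' x)) (xy).
  by apply: cluster_refl; apply: ww'; exact: cluster_source xy.
by move=> a b xa _ /ww' wb ab; exact: cluster_step xa ab wb.
Qed.

Lemma cluster_vacant w x : ~~ w x -> cluster w x = set0.
Proof. by move=> wx; rewrite -subset0 => y /cluster_source; apply/negP. Qed.

Lemma finite_sup_norm_le n : finite_set [set x : 'rV[int]_d | (sup_norm x <= n)%N].
Proof. by apply: sub_finite_set (finite_box d n) => x /boxE. Qed.

Definition boxf (n : nat) : {fset site d} := fset_set (@box d n).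

Lemma in_boxf n x : (x \in boxf n) = (sup_norm x <= n)%N.
Proof.
rewrite in_fset_set; last exact: finite_box.
by apply/idP/idP => [/set_mem/boxE//|/boxE h]; apply/mem_set.
Qed.

Lemma fset_in_boxf (A : {fset site d}) : exists n, {subset A <= boxf n}.
Proof.
exists (\max_(x <- A) sup_norm x)%N => x xA.
by rewrite in_boxf (big_rem x)//= leq_maxl.
Qed.

Definition boundary (A : {fset site d}) : {fset site d} :=
  fset_set [set y | y \notin A /\ exists2 x, x \in A & adjacent x y].

Lemma boundaryP (A : {fset site d}) y :
  reflect (y \notin A /\ exists2 x, x \in A & adjacent x y) (y \in boundary A).
Proof.
rewrite in_fset_set; first by apply: (iffP idP) => [/set_mem|/mem_set].
have [n An] := fset_in_boxf A.
apply: sub_finite_set (finite_sup_norm_le n.+1) => z /= [_ [x /An]].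
rewrite in_boxf => xn /sup_norm_adjacent h.
exact: leq_trans h _.
Qed.

End clusters.
Arguments boxf {d} n.

(** * The event that a given set is a cluster *)

Section isolated_clusters.
Variable d : nat.
Implicit Types (x y z : 'rV[int]_d) (w : 'rV[int]_d -> bool) (A : {fset site d}).

Definition closed_nbhd A : {fset site d} := (A `|` boundary A)%fset.

(** For a connected [A] this is the event that [A] is a cluster, in a form that
    shows on which sites it depends. *)
Definition isolated_event A : set (config (site d)) :=
  cylinder (closed_nbhd A) (fun x => x \in A).

Definition connected_fset A :=
  forall x y, x \in A -> y \in A -> cluster (fun z => z \in A) x y.

(** Vacating the closed neighbourhood of a cluster removes that cluster and
    leaves all the others unchanged ([cluster_erase]). *)
Definition erase A w : 'rV[int]_d -> bool := fun x => (x \notin closed_nbhd A) && w x.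

Lemma in_closed_nbhd A x y : x \in A -> adjacent x y -> y \in closed_nbhd A.
Proof.
move=> xA xy; rewrite inE; have [//|yA /=] := boolP (y \in A).
by apply/boundaryP; split => //; exists x.
Qed.

Lemma isolated_occupied A w x : isolated_event A w -> x \in A -> w x.
Proof. by move=> iA xA; rewrite iA// inE xA. Qed.

Lemma isolated_boundary A w x : isolated_event A w -> x \in boundary A -> ~~ w x.
Proof.
move=> iA xA; rewrite iA; first by have /boundaryP[] := xA.
by rewrite inE xA orbT.
Qed.

Lemma isolated_step A w x y :
  isolated_event A w -> x \in A -> adjacent x y -> w y -> y \in A.
Proof. by move=> iA xA xy; rewrite (iA y (in_closed_nbhd xA xy)). Qed.

Lemma isolated_cluster A w x : connected_fset A -> x \in A -> isolated_event A w ->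
  cluster w x = [set` A].
Proof.
move=> cA xA iA; apply/seteqP; split=> y /=.
  apply: (@cluster_ind _ w x (fun y => y \in A)) => // a b aA _ wb ab.
  exact: isolated_step ab wb.
move=> yA; apply: cluster_mono (cA _ _ xA yA) => z; exact: isolated_occupied.
Qed.

Lemma cluster_isolated A w x :
  x \in A -> cluster w x = [set` A] -> isolated_event A w.
Proof.
move=> xA cA y; rewrite inE => /orP[yA|/boundaryP[yA [z zA zy]]].
  by rewrite yA; apply: (@cluster_occupied _ w x); rewrite cA.
rewrite (negbTE yA); apply/negbTE; apply: contra yA => wy.
have : cluster w x y by apply: cluster_step zy wy; rewrite cA.
by rewrite cA.
Qed.

Lemma cluster_connected A w x : x \in A -> cluster w x = [set` A] ->
  connected_fset A.
Proof.
move=> xA cA.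
have cx y : y \in A -> cluster (fun z => z \in A) x y.
  move=> yA; have cy : cluster w x y by rewrite cA.
  suff [] : cluster w x y /\ cluster (fun z => z \in A) x y by [].
  pose B y := cluster w x y /\ cluster (fun z => z \in A) x y.
  apply: (@cluster_ind _ w x B) (cy).
    by split; [apply: cluster_refl; exact: cluster_source cy|exact: cluster_refl].
  move=> a b [wa Aa] _ wb ab; have xb := cluster_step wa ab wb.
  by split => //; apply: cluster_step Aa ab _; move: xb; rewrite cA.
by move=> y z /cx xy /cx; apply: cluster_trans; exact: cluster_sym.
Qed.

Lemma cluster_erase A w y : isolated_event A w -> y \notin A ->
  cluster (erase A w) y = cluster w y.
Proof.
move=> iA yA; apply/seteqP; split; first by apply: cluster_mono => z /andP[].
move=> z yz.
have off x : x \notin A -> w x -> erase A w x.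
  move=> xA wx; rewrite /erase wx andbT inE negb_or xA /=.
  by apply: contraL wx; exact: isolated_boundary.
suff [] : z \notin A /\ cluster (erase A w) y z by [].
apply: (@cluster_ind _ w y (fun z => z \notin A /\ cluster (erase A w) y z)) (yz).
  by split => //; apply: cluster_refl; apply: off => //; exact: cluster_source yz.
move=> a b [aA ya] wa wb ab.
have bA : b \notin A.
  by apply: contra aA => bA; apply: (isolated_step iA bA _ wa); rewrite adjacentC.
by split => //; apply: cluster_step ya ab _; exact: off.
Qed.

Lemma erase_in A w y : y \in A -> ~~ erase A w y.
Proof. by move=> yA; rewrite /erase inE yA. Qed.

Lemma Cmax_leP n k w : (Cmax n w <= k)%N <->
  (forall x, x \in @boxf d n -> forall A, cluster w x = [set` A] -> (#|` A| <= k)%N).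
Proof.
split=> [/bigmax_leqP_seq h x xn A cA|h].
  by have := h x xn; rewrite cA set_fsetK; apply; apply/asboolP; exact: finite_fset.
apply/bigmax_leqP_seq => x xn /asboolP /finite_fsetP[A cA].
by rewrite cA set_fsetK; exact: h cA.
Qed.

Lemma Cmax_attained n w : (0 < Cmax n w)%N ->
  exists x A, [/\ x \in @boxf d n, x \in A, cluster w x = [set` A] & #|` A| = Cmax n w].
Proof.
move=> C0; apply: contrapT => nex.
suff : (Cmax n w <= (Cmax n w).-1)%N by lia.
apply/Cmax_leP => x xn A cA.
have [A0|] := leqP #|` A| 0; first by lia.
rewrite cardfs_gt0 => /fset0Pn[y yA].
have xA : x \in A.
  have wx : w x by apply: (@cluster_source _ w x y); rewrite cA.
  have : cluster w x x by exact: cluster_refl.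
  by rewrite cA.
have le : (#|` A| <= Cmax n w)%N by have /Cmax_leP h := leqnn (Cmax n w); exact: h cA.
suff : #|` A| != Cmax n w by lia.
by apply/eqP => e; apply: nex; exists x, A.
Qed.

(** Phrased with [erase], so that it depends only on the sites off the closed
    neighbourhood of [A] and is independent of [isolated_event A]. *)
Definition others_le n k A : set (config (site d)) :=
  [set w | (Cmax n (erase A w) <= k)%N].

Lemma measurable_others n k A : measurable (others_le n k A).
Proof.
have mf : measurable_fun setT (erase A : config (site d) -> config (site d)).
  apply: measurable_fun_config => x; rewrite /erase.
  case: (x \notin _) => /=; first exact: measurable_site.
  by rewrite (_ : [set _ | _] = set0) ?measurable0//; apply/seteqP; split.
have := mf measurableT _ (measurable_Cmax_le n k).
by rewrite setTI.
Qed.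

(** A cluster of more than [k] sites that meets the box and differs from [A']
    would be one of the other clusters, which have at most [k] sites. *)
Lemma isolated_unique n k A A' w : connected_fset A -> connected_fset A' ->
  (k < #|` A|)%N -> (k < #|` A'|)%N ->
  (exists2 x, x \in A & x \in boxf n) -> 
  isolated_event A w -> isolated_event A' w -> others_le n k A' w -> A = A'.
Proof.
move=> cA cA' kA kA' [x xA xn] iA iA' oA'.
have [xA'|xA'] := boolP (x \in A').
  have := isolated_cluster cA xA iA; rewrite (isolated_cluster cA' xA' iA').
  by move=> /(congr1 (@fset_set _)); rewrite !set_fsetK => ->.
move: oA' => /Cmax_leP /(_ x xn A); rewrite (cluster_erase iA' xA').
by rewrite (isolated_cluster cA xA iA) => /(_ erefl); lia.
Qed.

Lemma Cmax_others n A w x : x \in boxf n -> x \in A -> cluster w x = [set` A] ->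
  others_le n (Cmax n w) A w.
Proof.
move=> xn xA cA; apply/Cmax_leP => y yn B.
have iA := cluster_isolated xA cA.
have [yA|yA] := boolP (y \in A).
  rewrite cluster_vacant ?erase_in// => /(congr1 (@fset_set _)).
  by rewrite set_fsetK fset_set0 => <-; rewrite cardfs0.
rewrite cluster_erase// => cB.
by have /Cmax_leP h := leqnn (Cmax n w); exact: h cB.
Qed.

Section weights.
Variables (R : realType) (p : R) (P : probability (config (site d)) R).
Hypothesis HP : is_bernoulli_product p P.

Lemma pr_isolated A :
  pr P (isolated_event A) = p ^+ #|` A| * (1 - p) ^+ #|` boundary A|.
Proof.
rewrite /pr HP /= (perm_big (A ++ boundary A)) /=; last first.
  apply: uniq_perm; first exact: fset_uniq.
    rewrite cat_uniq !fset_uniq andbT /=; apply/hasPn => x /boundaryP[xA _].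
    exact: xA.
  by move=> x; rewrite mem_cat inE.
rewrite big_cat /=; congr (_ * _).
  rewrite (eq_big_seq (fun=> p)); last by move=> x xA; rewrite /bernoulli_pmf xA.
  by rewrite big_const_seq count_predT iter_mulr_1.
rewrite (eq_big_seq (fun=> 1 - p)); last first.
  by move=> x /boundaryP[xA _]; rewrite /bernoulli_pmf (negbTE xA).
by rewrite big_const_seq count_predT iter_mulr_1.
Qed.

Definition isolated_weight n k A := pr P (isolated_event A `&` others_le n k A).

Lemma isolated_weightE n k A : isolated_weight n k A =
  p ^+ #|` A| * (1 - p) ^+ #|` boundary A| * pr P (others_le n k A).
Proof.
have mI : measurable (isolated_event A) by exact: measurable_cylinder.
have mO := measurable_others n k A.
rewrite -pr_isolated /isolated_weight /pr.
rewrite (independence HP (U := mem (closed_nbhd A)))//.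
- by rewrite (prE P mI) (prE P mO).
- by move=> w w' ww' iA x xA; rewrite -ww'// iA.
- move=> w w' ww'; rewrite /others_le /= (_ : erase A w = erase A w')//.
  apply/funext => x; rewrite /erase; have [//|xA /=] := boolP (x \in _).
  by rewrite ww'// inE /=.
Qed.

End weights.
End isolated_clusters.

(** * Blocks of side three *)

Section blocks.
Variable d : nat.
Implicit Types (x y z v : 'rV[int]_d) (A : {fset site d}).

Definition hub v : 'rV[int]_d := \row_i (3 * v 0 i).

Definition block x : 'rV[int]_d := \row_i ((x 0%R i + 1) %/ 3)%Z.

Lemma blockP x v : reflect (block x = v) (sup_norm (x - hub v) <= 1)%N.
Proof.
apply: (iffP idP) => [/sup_norm_leP h|<-].
  apply/rowP => i; have := h i; rewrite !mxE. move: (x 0 i) (v 0 i) => a b. lia.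
by apply/sup_norm_leP => i; rewrite !mxE; move: (x 0 i) => a; lia.
Qed.

(** The sites of the block [v] other than its central site [hub v]. *)
Definition rim v x := sup_norm (x - hub v) == 1%N.

Lemma rim_block v x : rim v x -> block x = v.
Proof. by move=> /eqP e; apply/blockP; rewrite e. Qed.

Lemma block_hub v : block (hub v) = v.
Proof.
by apply/blockP; rewrite subrr; apply/sup_norm_leP => i; rewrite mxE.
Qed.

Lemma block_rim_or_hub v x : block x = v -> x = hub v \/ rim v x.
Proof.
move=> /blockP; rewrite leq_eqVlt => /orP[h|]; first by right.
rewrite ltnS => /sup_norm_leP h; left; apply/rowP => i.
by have := h i; rewrite !mxE; move: (x 0 i) (v 0 i) => a b; lia.
Qed.

Lemma rim_adjacent_hub v x : adjacent (hub v) x -> rim v x.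
Proof.
move=> ax; have bx : block x = v.
  apply/blockP/sup_norm_leP => i; have := adjacent_le1 i ax; rewrite !mxE.
  by move: (x 0 i) (v 0 i) => a b; lia.
have [e|//] := block_rim_or_hub bx.
by move: (adjacent_neq ax); rewrite e eqxx.
Qed.

Lemma hub_inj : injective hub.
Proof.
move=> u u' /rowP h; apply/rowP => i; have := h i; rewrite !mxE.
by move: (u 0 i) (u' 0 i) => a b; lia.
Qed.

Hypothesis d2 : (2 <= d)%N.

Lemma hub_not_rim v u : rim u (hub v) = false.
Proof.
apply/negP => r; have uv := rim_block r; move: r.
rewrite block_hub in uv; rewrite uv /rim subrr => /eqP.
by have [i <-] := sup_norm_attained 0 (ltnW d2); rewrite mxE.
Qed.

Lemma hub_neighbour v : exists2 x, adjacent (hub v) x & rim v x.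
Proof.
have d0 : (0 < d)%N by lia.
pose i := Ordinal d0.
have ax : adjacent (hub v) (upd (hub v) i (hub v 0 i + 1)).
  by apply: adjacent_upd; rewrite opprD addNKr normrN1.
by exists (upd (hub v) i (hub v 0 i + 1)) => //; exact: rim_adjacent_hub.
Qed.

(** The rim is a translate of the shell of radius one. *)
Lemma rim_connected v (B : 'rV[int]_d -> Prop) x z :
  (forall y z, rim v y -> rim v z -> adjacent y z -> B y -> B z) ->
  rim v x -> rim v z -> B x -> B z.
Proof.
move=> clB /eqP rx /eqP rz Bx.
have := @shell_connected _ 1 (fun y => B (y + hub v)) (x - hub v) (z - hub v) d2.
rewrite !subrK; apply => // a b a1 b1 ab; apply: clB; rewrite /rim ?addrK ?a1 ?b1//.
by rewrite adjacentDr.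
Qed.

Definition good A v := `[< forall x, rim v x -> x \in A >].

Definition good_blocks A : {fset site d} := [fset v in block @` A | good A v]%fset.

Definition filled_blocks A : {fset site d} :=
  [fset v in good_blocks A | hub v \in A]%fset.

(** The blocks that have to be inspected in order to decide whether [A] is a
    cluster. *)
Definition explored_blocks A : {fset site d} := (block @` closed_nbhd A)%fset.

Lemma good_blocksP A v :
  reflect (forall x, rim v x -> x \in A) (v \in good_blocks A).
Proof.
rewrite !inE /=; apply: (iffP andP) => [[_ /asboolP//]|h].
split; last exact/asboolP.
have [x _ rx] := hub_neighbour v.
by apply/imfsetP; exists x; [exact: h|rewrite (rim_block rx)].
Qed.

Lemma filled_blocksE A v :
  (v \in filled_blocks A) = (v \in good_blocks A) && (hub v \in A).
Proof. by rewrite inE. Qed.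

Lemma filled_le_good A : (#|` filled_blocks A| <= #|` good_blocks A|)%N.
Proof.
by apply/fsubset_leq_card/fsubsetP => v; rewrite filled_blocksE => /andP[].
Qed.

Lemma good_sub_explored A : {subset good_blocks A <= explored_blocks A}.
Proof.
move=> v /good_blocksP h; have [x _ rx] := hub_neighbour v.
by apply/imfsetP; exists x; rewrite ?(rim_block rx)//= inE h.
Qed.

(** Filling a good block adds one site to [A], moves that site out of the
    boundary, and changes neither the closed neighbourhood nor the set of good
    blocks, because the hub of a block lies in no rim. *)
Section fill.
Variables (A : {fset site d}) (v : 'rV[int]_d).
Hypotheses (gv : v \in good_blocks A) (cv : hub v \notin A).
Let A' : {fset site d} := (hub v |` A)%fset.

Let rimA x : rim v x -> x \in A.
Proof. by move: x; apply/good_blocksP. Qed.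

Lemma hub_boundary : hub v \in boundary A.
Proof.
have [x ax rx] := hub_neighbour v.
by apply/boundaryP; split => //; exists x; [exact: rimA|rewrite adjacentC].
Qed.

Lemma boundary_fill : boundary A' = (boundary A `\ hub v)%fset.
Proof.
apply/fsetP => y; rewrite in_fsetD1; apply/boundaryP/andP.
  rewrite !inE negb_or => -[/andP[yv yA] [x]].
  rewrite !inE => /orP[/eqP-> cy|xA xy].
    by move: yA; rewrite rimA//; exact: rim_adjacent_hub.
  by split => //; apply/boundaryP; split => //; exists x.
move=> [yv /boundaryP[yA [x xA xy]]]; rewrite !inE negb_or yv yA; split=> //.
by exists x => //; rewrite !inE xA orbT.
Qed.

Lemma closed_nbhd_fill : closed_nbhd A' = closed_nbhd A.
Proof.
apply/fsetP => y; rewrite /closed_nbhd boundary_fill !inE.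
by case: eqP => //= ->; rewrite hub_boundary orbT.
Qed.

Lemma connected_fill : connected_fset A -> connected_fset A'.
Proof.
move=> cA.
have [x ax rx] := hub_neighbour v.
have sub y : y \in A -> y \in A' by move=> yA; rewrite !inE yA orbT.
have cx y : y \in A' -> cluster (fun z => z \in A') x y.
  rewrite !inE => /orP[/eqP->|yA].
    apply: (@cluster_step _ _ _ x); rewrite 1?adjacentC// ?fset1U1//.
    by apply: cluster_refl; apply: sub; exact: rimA.
  by apply: cluster_mono (cA _ _ (rimA rx) yA) => z; exact: sub.
by move=> y z /cx xy /cx; apply: cluster_trans; exact: cluster_sym.
Qed.

Lemma good_blocks_fill : good_blocks A' = good_blocks A.
Proof.
apply/fsetP => u; apply/good_blocksP/good_blocksP => h x rx; last first.
  by rewrite !inE h ?orbT.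
have := h x rx; rewrite !inE => /orP[/eqP xv|//].
by move: rx; rewrite xv hub_not_rim.
Qed.

Lemma filled_blocks_fill : filled_blocks A' = (v |` filled_blocks A)%fset.
Proof.
apply/fsetP => u; rewrite in_fset1U !filled_blocksE good_blocks_fill in_fset1U.
by rewrite (inj_eq hub_inj); case: eqP => [->|_] //=; rewrite gv.
Qed.

Lemma card_filled_fill : #|` filled_blocks A'| = (#|` filled_blocks A|).+1.
Proof. by rewrite filled_blocks_fill cardfsU1 filled_blocksE (negbTE cv) andbF. Qed.

Lemma card_boundary_fill : #|` boundary A| = (#|` boundary A'|).+1.
Proof. by rewrite boundary_fill (cardfsD1 (hub v)) hub_boundary. Qed.

Lemma card_fill : #|` A'| = (#|` A|).+1.
Proof. by rewrite cardfsU1 cv. Qed.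

Variables (R : realType) (p : R) (P : probability (config (site d)) R).
Hypothesis HP : is_bernoulli_product p P.

(** Since the closed neighbourhood is the same, so is the condition on the other
    clusters; only the state of the hub is changed. *)
Lemma isolated_weight_fill n k :
  isolated_weight P n k A * p = isolated_weight P n k A' * (1 - p).
Proof.
rewrite (isolated_weightE HP n k A) (isolated_weightE HP n k A').
rewrite card_boundary_fill card_fill.
rewrite (_ : others_le n k A' = others_le n k A); last first.
  by rewrite /others_le /erase closed_nbhd_fill.
rewrite !exprS; move: (pr _ _) (_ ^+ _) (_ ^+ _) => a b c; ring.
Qed.

End fill.
End blocks.

(** * Comparing the weights of clusters of neighbouring sizes *)

Lemma ler_sum_sub_uniq (R : numDomainType) (J : eqType) (t s : seq J) (h : J -> R) :
  uniq t -> uniq s -> {subset t <= s} -> (forall j, j \in s -> 0 <= h j) ->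
  \sum_(j <- t) h j <= \sum_(j <- s) h j.
Proof.
move=> ut us ts h0.
have pe : perm_eq t [seq j <- s | j \in t].
  apply: uniq_perm => //; first exact: filter_uniq.
  by move=> j; rewrite mem_filter; case: (boolP (j \in t)) => // /ts ->.
rewrite (perm_big _ pe) /= big_filter big_mkcond /= big_seq [leRHS]big_seq.
by apply: ler_sum => j js; case: ifP => // _; exact: h0.
Qed.

Lemma ler_sum_inj (R : numDomainType) (I J : eqType) (s : seq I) (s' : seq J)
    (f : I -> J) (P : pred I) (Q : pred J) (h : J -> R) :
  uniq s -> uniq s' -> (forall j, j \in s' -> 0 <= h j) ->
  {in [pred i | (i \in s) && P i] &, injective f} ->
  (forall i, i \in s -> P i -> (f i \in s') && Q (f i)) ->
  \sum_(i <- s | P i) h (f i) <= \sum_(j <- s' | Q j) h j.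
Proof.
move=> us us' h0 finj fs.
rewrite -big_filter -[leRHS]big_filter -(big_map f predT).
apply: ler_sum_sub_uniq.
- rewrite map_inj_in_uniq ?filter_uniq// => x y.
  by rewrite !mem_filter ![_ && (_ \in s)]andbC => xs ys; apply: finj.
- exact: filter_uniq.
- move=> _ /mapP[x /[!mem_filter]/andP[Px xs] ->].
  by have /andP[-> ->] := fs x xs Px.
- by move=> j; rewrite mem_filter => /andP[_ /h0].
Qed.

Lemma count_le1 (I : eqType) (s : seq I) (P : pred I) :
  uniq s -> (forall x y, x \in s -> y \in s -> P x -> P y -> x = y) ->
  (count P s <= 1)%N.
Proof.
move=> us h; rewrite -size_filter.
case e : [seq i <- s | P i] => [|x [|y l]] //=.
have u : uniq [seq i <- s | P i] by exact: filter_uniq.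
have : x \in [seq i <- s | P i] by rewrite e inE eqxx.
have : y \in [seq i <- s | P i] by rewrite e !inE eqxx orbT.
rewrite !mem_filter => /andP[Py ys] /andP[Px xs].
by move: u; rewrite e /= inE (h x y)// eqxx.
Qed.

Lemma sum_fset_sub (R : nmodType) (K : choiceType) (D E : {fset K}) (c : R) :
  {subset D <= E} -> \sum_(v <- E | v \in D) c = c *+ #|` D|.
Proof.
move=> DE; rewrite big_fset_condE (_ : [fset i in E | _]%fset = D).
  by rewrite big_const_seq count_predT -Monoid.iteropE.
apply/fsetP => v; rewrite !inE /=.
by case: (boolP (v \in D)) => [/DE ->|]; rewrite ?andbF.
Qed.

Section swap.
Variable d : nat.
Hypothesis d2 : (2 <= d)%N.
Variables (R : realType) (p a e : R) (P : probability (config (site d)) R).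
Hypotheses (p01 : 0 < p < 1) (HP : is_bernoulli_product p P).
Hypotheses (pa : p <= a) (a1 : a < 1).
Variables n k N : nat.
Implicit Types (A : {fset site d}).

(** The bound on the number of filled blocks is relaxed by one with each added
    site, so that filling a block of a [t]-typical set gives a [t.+1]-typical
    one. The margin [e] absorbs these relaxations: up to [t = e], at most a
    fraction [a] of the good blocks is filled. *)
Definition typical t A : Prop :=
  [/\ connected_fset A, exists2 x, x \in A & x \in boxf n, #|` A| = (k + t)%N &
   #|` filled_blocks A|%:R <= a * #|` good_blocks A|%:R - e + t%:R].

(** The box of half-width [3 * N + 1] is a union of blocks, those indexed by the
    box of half-width [N], so filling blocks does not leave it. *)
Definition typical_sets t : seq {fset site d} :=
  [seq A <- fpowerset (@boxf d (3 * N + 1)) | `[< typical t A >]].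

Definition typical_mass t : R := \sum_(A <- typical_sets t) isolated_weight P n k A.

Lemma typical_setsP t A : reflect ({subset A <= boxf (3 * N + 1)} /\ typical t A)
  (A \in typical_sets t).
Proof.
rewrite mem_filter fpowersetE andbC; apply: (iffP andP).
  by move=> [/fsubsetP ? /asboolP].
by move=> [? ?]; split; [exact/fsubsetP|exact/asboolP].
Qed.

Lemma good_blocks_box A (v : site d) :
  {subset A <= boxf (3 * N + 1)} -> v \in good_blocks A ->
  (v \in boxf N) && (hub v \in boxf (3 * N + 1)).
Proof.
move=> AN /(good_blocksP d2) gv.
have [x _ rx] := hub_neighbour d2 v.
have := AN x (gv x rx); rewrite !in_boxf => /sup_norm_leP xN.
have /sup_norm_leP rx1 : (sup_norm (x - hub v)%R <= 1)%N by move: rx => /eqP ->.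
by apply/andP; split; apply/sup_norm_leP => i; have := rx1 i; have := xN i;
  rewrite !mxE; move: (x 0 i) (v 0 i) => b c; lia.
Qed.

Lemma isolated_weight_ge0 A : 0 <= isolated_weight P n k A.
Proof. exact: pr_ge0. Qed.

(** For [a = p] this is 1; it tends to 1 as [a] decreases to [p]. *)
Let ratio := a * (1 - p) / ((1 - a) * p).

(** Double counting of the pairs ([A], [v]) where [v] is a good block of [A] that
    is not filled. From [A] there are [m - j] ways to fill a block; a set with
    [j] filled blocks arises in at most [j] ways. The weights of the two sets
    are in the ratio [(1 - p) / p], and [j / (m - j + 1) <= a / (1 - a)] as soon
    as [j <= a * m]. *)
Lemma typical_mass_step t : t.+1%:R <= e ->
  typical_mass t <= ratio * typical_mass t.+1.
Proof.
move=> te; move: p01 => /andP[p0 p1].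
pose D A := (good_blocks A `\` filled_blocks A)%fset.
pose m A : R := #|` good_blocks A|%:R.
pose j A : R := #|` filled_blocks A|%:R.
pose g A := isolated_weight P n k A * ((1 - p) / p) / (m A - j A + 1).
have jm A : j A <= m A by rewrite ler_nat filled_le_good.
have g0 A : 0 <= g A.
  rewrite /g divr_ge0 ?mulr_ge0 ?isolated_weight_ge0 ?invr_ge0//; first lra.
    exact: ltW.
  by have := jm A; lra.
have fg A : (filled_blocks A `<=` good_blocks A)%fset.
  by apply/fsubsetP => v; rewrite filled_blocksE => /andP[].
have cD A : #|` D A|%:R = m A - j A.
  rewrite /m -(cardfsID (filled_blocks A) (good_blocks A)) natrD.
  by rewrite (fsetIidPr (fg A)) addrC addKr.
have inD A v : (v \in D A) = (v \in good_blocks A) && (hub v \notin A).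
  rewrite /D in_fsetD filled_blocksE.
  by case: (v \in good_blocks A) => //=; rewrite andbT.
(* [g] of a filled set is the share of the weight of [A] carried by one filling. *)
have stepA A : A \in typical_sets t ->
    isolated_weight P n k A = \sum_(v <- boxf N | v \in D A) g (hub v |` A)%fset.
  move=> /typical_setsP[AN [cA mA kA jA]].
  have jA1 : j A + 1 <= a * m A by move: jA te; rewrite -/(j A) -/(m A) -natr1; lra.
  have j0 : 0 <= j A by exact: ler0n.
  have a0 : 0 < a by exact: lt_le_trans p0 pa.
  have jm1 : 0 < m A - j A.
    move: jA1 j0 a0; move: (m A) (j A) => x y *.
    have x0 : 0 < x by rewrite -(pmulr_rgt0 _ (_ : 0 < a))//; lra.
    have : 0 < (1 - a) * x by rewrite mulr_gt0// subr_gt0.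
    lra.
  rewrite (eq_bigr (fun=> isolated_weight P n k A / (m A - j A))); last first.
    move=> v; rewrite inD => /andP[gv cv]; rewrite /g.
    have := isolated_weight_fill d2 gv cv HP n k.
    rewrite /m /j good_blocks_fill// card_filled_fill// -natr1 -/(m A) -/(j A).
    move=> e1; rewrite (_ : isolated_weight _ _ _ _ * _ = isolated_weight P n k A).
      by congr (_ / _); ring.
    by rewrite mulrA -e1 mulfK// gt_eqF.
  rewrite sum_fset_sub.
    by rewrite -mulr_natr cD divfK// gt_eqF.
  by move=> v; rewrite inD => /andP[gv _]; have /andP[] := good_blocks_box AN gv.
rewrite /typical_mass big_seq (eq_bigr _ stepA) -big_seq.
rewrite (exchange_big_dep predT)//= mulr_sumr.
(* For a fixed [v], the set before filling is recovered by removing [hub v]. *)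
apply: (@le_trans _ _ (\sum_(v <- boxf N)
    \sum_(A <- typical_sets t.+1 | v \in filled_blocks A) g A)).
  apply: ler_sum => v _.
  apply: (ler_sum_inj (f := fun A => (hub v |` A)%fset)) => //.
  - by apply: filter_uniq; exact: fset_uniq.
  - by apply: filter_uniq; exact: fset_uniq.
  - move=> A B /andP[_ /=]; rewrite inD => /andP[_ cA].
    move=> /andP[_ /=]; rewrite inD => /andP[_ cB] AB.
    apply/fsetP => x; have /fsetP/(_ x) := AB; rewrite !inE.
    by case: eqP => //= ->; rewrite (negbTE cA) (negbTE cB).
  - move=> A /typical_setsP[AN [cA [x xA xn] kA jA]]; rewrite inD => /andP[gv cv].
    apply/andP; split; last by rewrite filled_blocks_fill// fset1U1.
    apply/typical_setsP; split.
      move=> y; rewrite !inE => /orP[/eqP->|/AN//].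
      by have /andP[] := good_blocks_box AN gv.
    split.
    + exact: connected_fill.
    + by exists x => //; rewrite inE xA orbT.
    + by rewrite card_fill// kA addnS.
    + by rewrite good_blocks_fill// card_filled_fill// -!natr1; lra.
rewrite (exchange_big_dep predT)//= big_seq [leRHS]big_seq.
apply: ler_sum => A /typical_setsP[AN [cA mA kA jA]].
rewrite sum_fset_sub; last first.
  move=> v; rewrite filled_blocksE => /andP[gv _].
  by have /andP[] := good_blocks_box AN gv.
rewrite -mulr_natr -/(j A) /g.
have jA1 : j A <= a * m A by move: jA te; rewrite -/(j A) -/(m A); lra.
have W0 := isolated_weight_ge0 A.
have mj : 0 < m A - j A + 1 by have := jm A; lra.
rewrite (_ : _ * j A = isolated_weight P n k A * ((1 - p) / p) *
  (j A / (m A - j A + 1))); last ring.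
rewrite (_ : ratio * _ =
    isolated_weight P n k A * ((1 - p) / p) * (a / (1 - a))); last first.
  have pn : p != 0 by rewrite gt_eqF.
  have an : 1 - a != 0 by rewrite gt_eqF// subr_gt0.
  by rewrite /ratio; field; rewrite ?pn ?an.
apply: ler_wpM2l; first by rewrite mulr_ge0// divr_ge0//; lra.
rewrite ler_pdivrMr// mulrAC ler_pdivlMr; last by rewrite subr_gt0.
have a0 : 0 < a by exact: lt_le_trans p0 pa.
by move: jA1; move: (m A) (j A) => x y *; lra.
Qed.

Lemma ratio_ge1 : 1 <= ratio.
Proof.
move: p01 pa a1 => /andP[p0 p1] pa1 a11; rewrite /ratio ler_pdivlMr; first by nra.
by rewrite mulr_gt0// subr_gt0.
Qed.

Lemma typical_mass_ge0 t : 0 <= typical_mass t.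
Proof. by apply: sumr_ge0 => A _; exact: isolated_weight_ge0. Qed.

(** For [t >= 1] the set has more than [k] sites, so it is determined by the
    configuration, by [isolated_unique]. For [t = 0] this fails: several
    clusters may have exactly [k] sites. *)
Lemma sum_typical_mass_le1 T : \sum_(t <- iota 1 T) typical_mass t <= 1.
Proof.
have -> : \sum_(t <- iota 1 T) typical_mass t =
    \sum_(A <- [seq A | t <- iota 1 T, A <- typical_sets t]) isolated_weight P n k A.
  by rewrite big_allpairs_dep.
have := @pr_sum_overlap_le _ _ _ P _ [seq A | t <- iota 1 T, A <- typical_sets t]
  (fun A => isolated_event A `&` others_le n k A) 1.
apply.
  move=> A _; apply: measurableI; [exact: measurable_cylinder|exact: measurable_others].
move=> w; apply: count_le1.
  apply: allpairs_uniq_dep => /=; first exact: iota_uniq.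
    by move=> t _; apply: filter_uniq; exact: fset_uniq.
  move=> [t A] [u B] /allpairsPdep[t' [A' [_ /typical_setsP[_ [_ _ cA _]] [-> ->]]]].
  move=> /allpairsPdep[u' [B' [_ /typical_setsP[_ [_ _ cB _]] [-> ->]]]] /= AB.
  by move: cB; rewrite -AB cA => /addnI ->.
move=> A B /allpairsPdep[t [A1 [tT /typical_setsP[_ [cA mA kA _]] ->]]].
move=> /allpairsPdep[u [B1 [uT /typical_setsP[_ [cB _ kB _]] ->]]].
move=> /asboolP[iA _] /asboolP[iB oB].
apply: (isolated_unique cA cB _ _ mA iA iB oB); [rewrite kA|rewrite kB];
 by move: tT uT; rewrite !mem_iota; lia.
Qed.

(** The mass for size [k] is at most twice the mass for each of the sizes
    [k + 1], ..., [k + T], and the latter add up to at most 1. *)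
Lemma typical_mass0_le T :
  T%:R <= e -> ratio ^+ T <= 2 -> typical_mass 0 * T%:R <= 2.
Proof.
move=> Te rT.
have h t : (t <= T)%N -> typical_mass 0 <= ratio ^+ t * typical_mass t.
  elim: t => [|t IHt] tT; first by rewrite expr0 mul1r.
  apply: le_trans (IHt (ltnW tT)) _; rewrite exprSr -mulrA ler_wpM2l ?exprn_ge0//.
    by rewrite (le_trans ler01)// ratio_ge1.
  by apply: typical_mass_step; rewrite (le_trans _ Te)// ler_nat.
have -> : typical_mass 0 * T%:R = \sum_(t <- iota 1 T) typical_mass 0.
  by rewrite big_const_seq count_predT size_iota iter_addr_0 mulr_natr.
apply: (@le_trans _ _ (\sum_(t <- iota 1 T) 2 * typical_mass t)).
  rewrite big_seq [leRHS]big_seq; apply: ler_sum => t; rewrite mem_iota => tT.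
  have tT' : (t <= T)%N by lia.
  apply: le_trans (h t tT') _; rewrite ler_wpM2r ?typical_mass_ge0//.
  by rewrite (le_trans _ rT)// ler_weXn2l// ratio_ge1.
by rewrite -mulr_sumr ler_piMr// sum_typical_mass_le1.
Qed.

End swap.

(** * A change of measure on blocks *)

(** Under the product law on [I -> J] with marginals [f], each product is the
    probability of the box of all [g] with [K a i (g i)] for every [i]. Two
    conflicting boxes are disjoint. *)
Lemma partial_assignment_sum (R : realDomainType) (I J : finType) (X : eqType)
    (s : seq X) (K : X -> I -> pred J) (f : J -> R) :
  (forall j, 0 <= f j) -> \sum_j f j = 1 -> uniq s ->
  (forall a b, a \in s -> b \in s -> a != b ->
     exists i, forall j, ~~ (K a i j && K b i j)) ->
  \sum_(a <- s) \prod_(i : I) \sum_(j | K a i j) f j <= 1.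
Proof.
move=> f0 f1 us conflict.
pose F (g : {ffun I -> J}) := \prod_i f (g i).
have F0 g : 0 <= F g by exact: prodr_ge0.
have F1 : \sum_g F g = 1.
  by rewrite /F -(bigA_distr_bigA (fun _ j => f j)) big1 // => i _.
under eq_bigr do rewrite (bigA_distr_big_dep _ (fun _ j => f j)).
rewrite (exchange_big_dep predT)//= -[leRHS]F1; apply: ler_sum => g _.
rewrite -/(F g) -big_filter.
set t := [seq a <- s | _].
have : (size t <= 1)%N.
  have ut : uniq t by exact: filter_uniq.
  have memt a : a \in t -> a \in s /\ forall i, K a i (g i).
    by rewrite mem_filter => /andP[/familyP h as_]; split => // i; exact: h.
  case et : t => [|a [|b l]] //=.
  have /memt[as_ ag] : a \in t by rewrite et inE eqxx.
  have /memt[bs bg] : b \in t by rewrite et !inE eqxx orbT.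
  have ab : a != b.
    by move: ut; rewrite et /= inE; case: eqP => // ->; rewrite eqxx.
  by have [i /(_ (g i))] := conflict a b as_ bs ab; rewrite ag bg.
rewrite big_const_seq count_predT; case: (size t) => [|[|//]] _.
  exact: F0.
by rewrite /= addr0.
Qed.

Section cells.
Variable d : nat.
Implicit Types (x y z v : 'rV[int]_d) (A : {fset site d}).

Definition cell : finType := {ffun 'I_d -> 'I_3}.

Definition position v (c : cell) : 'rV[int]_d := \row_i (3 * v 0 i + (c i : nat)%:Z - 1).

Definition middle : cell := [ffun=> inord 1].

Lemma block_position v c : block (position v c) = v.
Proof.
apply/blockP/sup_norm_leP => i; rewrite !mxE.
by have := ltn_ord (c i); move: (v 0 i) (nat_of_ord (c i)) => a b; lia.
Qed.

Lemma position_middle v : position v middle = hub v.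
Proof. by apply/rowP => i; rewrite !mxE ffunE inordK//; ring. Qed.

Lemma position_inj v : injective (position v).
Proof.
move=> c c' /rowP h; apply/ffunP => i; apply/val_inj; have := h i; rewrite !mxE /=.
by move: (v 0 i) (nat_of_ord (c i)) (nat_of_ord (c' i)) => a b b'; lia.
Qed.

Lemma position_surj v x : block x = v -> exists c, x = position v c.
Proof.
move=> /blockP/sup_norm_leP h.
exists [ffun i => inord `|(x 0 i - 3 * v 0 i + 1)%R|%N].
apply/rowP => i; rewrite !mxE ffunE; have := h i; rewrite !mxE => hi.
rewrite inordK; move: hi; move: (x 0 i) (v 0 i) => a b; lia.
Qed.

Hypothesis d2 : (2 <= d)%N.

Lemma rim_position v c : rim v (position v c) = (c != middle).
Proof.
have [->|cm] := eqVneq c middle.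
  by rewrite position_middle hub_not_rim.
have [e|//] := block_rim_or_hub (block_position v c).
by move: cm; rewrite -position_middle in e; rewrite (position_inj e) eqxx.
Qed.

Lemma rim_position_ex v x : rim v x -> exists2 c, x = position v c & c != middle.
Proof.
move=> r; have [c e] := position_surj (rim_block r).
by exists c => //; rewrite -(rim_position v) -e.
Qed.

Lemma card_fset_explored A : (#|` A| <= #|` explored_blocks A| * 3 ^ d)%N.
Proof.
pose s := [seq position v c | v <- explored_blocks A, c <- enum {: cell}].
have -> : (#|` explored_blocks A| * 3 ^ d = size s)%N.
  by rewrite size_allpairs -cardE card_ffun !card_ord.
apply: uniq_leq_size => // x xA.
have [c xc] := position_surj (erefl (block x)).
apply/allpairsP; exists (block x, c); split => //=; last by rewrite mem_enum.
by apply/imfsetP; exists x => //=; rewrite inE xA.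
Qed.

(** The block is good as seen from its own configuration; for an explored block
    and a compatible configuration this agrees with being good for [A]
    ([compatible_good]). *)
Definition all_rim (j : {ffun cell -> bool}) := [forall c, (c != middle) ==> j c].

Definition compatible A v (j : {ffun cell -> bool}) :=
  [forall c, (position v c \in closed_nbhd A) ==> (j c == (position v c \in A))].

Lemma compatibleP A v (j : {ffun cell -> bool}) : reflect
  (forall c, position v c \in closed_nbhd A -> j c = (position v c \in A))
  (compatible A v j).
Proof.
apply: (iffP forallP) => [h c cA|h c]; first by have /implyP/(_ cA)/eqP := h c.
by apply/implyP => /h ->.
Qed.

(** An explored block with a fully occupied rim has a rim site in [A]: the site
    that makes it explored, or a neighbour of that site if it is the hub. The
    occupied rim is connected and [A] has a vacant boundary, so the whole rim
    belongs to [A]. *)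
Lemma compatible_good A v (j : {ffun cell -> bool}) :
  v \in explored_blocks A -> compatible A v j ->
  all_rim j = (v \in good_blocks A).
Proof.
move=> /imfsetP[x /= xA vx] /compatibleP jA.
apply/forallP/good_blocksP => // [h|h c]; last first.
  apply/implyP => cm; have cA : position v c \in A by apply: h; rewrite rim_position.
  by rewrite jA ?cA// inE cA.
have rimA y : rim v y -> y \in closed_nbhd A -> y \in A.
  move=> /rim_position_ex[c -> cm] /jA <-.
  by have /implyP := h c; exact.
have [y ry yA] : exists2 y, rim v y & y \in A.
  have [xh|rx] := block_rim_or_hub (esym vx); last by exists x => //; exact: rimA.
  have [xA'|xA'] := boolP (x \in A).
    have [z az rz] := hub_neighbour d2 v.
    exists z => //; apply: rimA => //.
    by apply: (in_closed_nbhd xA'); rewrite xh.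
  move: xA; rewrite inE (negbTE xA') /= => /boundaryP[_ [u uA ux]].
  by exists u => //; apply: rim_adjacent_hub; rewrite adjacentC -xh.
move=> z rz; apply: (@rim_connected _ d2 v (fun z => z \in A) y) => // a b ra rb ab aA.
by apply: rimA => //; exact: in_closed_nbhd aA ab.
Qed.

(** When the rim is contained in [A], the hub lies in the closed neighbourhood
    of [A], where the configuration is prescribed. *)
Lemma compatible_filled A v (j : {ffun cell -> bool}) :
  v \in explored_blocks A -> compatible A v j ->
  all_rim j && j middle = (v \in filled_blocks A).
Proof.
move=> vA jA; rewrite (compatible_good vA jA) filled_blocksE.
have [/(good_blocksP d2) gv|//] := boolP (v \in good_blocks A) => /=.
have [x ax rx] := hub_neighbour d2 v.
rewrite -position_middle; move/compatibleP: jA; apply.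
rewrite position_middle; apply: (in_closed_nbhd (gv x rx)).
by rewrite adjacentC.
Qed.

(** If the prescriptions of [A] and [B] were compatible, then [A] could not leave
    [B] along a path from [x], since it would have to step on a boundary site
    of [B], and conversely. *)
Lemma connected_conflict A B x : connected_fset A -> connected_fset B ->
  x \in A -> x \in B -> A != B ->
  exists y, [/\ y \in closed_nbhd A, y \in closed_nbhd B & (y \in A) != (y \in B)].
Proof.
move=> cA cB xA xB AB; apply: contrapT => nex.
have agree y : y \in closed_nbhd A -> y \in closed_nbhd B -> (y \in A) = (y \in B).
  by move=> yA yB; apply/eqP/negPn/negP => ne; apply: nex; exists y.
have sub C D : connected_fset C -> x \in C -> x \in D ->
    (forall y, y \in closed_nbhd C -> y \in closed_nbhd D -> (y \in C) = (y \in D)) ->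
    {subset C <= D}.
  move=> cC xC xD CD y yC.
  apply: (@cluster_ind _ (fun z => z \in C) x (fun z => z \in D)) (cC x y xC yC) => //.
  move=> a b aD aC bC ab.
  by rewrite -CD//; [rewrite inE bC|exact: in_closed_nbhd aD ab].
move/eqP: AB; apply; apply/fsetP => y; apply/idP/idP; first exact: sub.
by apply: sub => // z zB zA; rewrite agree.
Qed.

End cells.

(** From [1 - u <= expR (- u)], by inversion. *)
Lemma expR_le_quadratic (R : realType) (u : R) : `|u| <= 2^-1 ->
  expR u <= 1 + u + 2 * u ^+ 2.
Proof.
rewrite ler_norml => /andP[u1 u2].
have u0 : 0 < 1 - u by lra.
have h : 1 - u <= expR (- u) by have := expR_ge1Dx (- u).
have -> : expR u = (expR (- u))^-1 by rewrite expRN invrK.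
apply: (@le_trans _ _ (1 - u)^-1).
  by rewrite lef_pV2// posrE// expR_gt0.
rewrite -div1r ler_pdivrMr// expr2.
have : 0 <= u * u * (1 - 2 * u) by rewrite mulr_ge0 ?sqr_ge0 -?expr2 ?sqr_ge0//; lra.
by nra.
Qed.

Section tilt.
Variables (d : nat) (R : realType) (p a : R).
Hypotheses (d2 : (2 <= d)%N) (p01 : 0 < p < 1) (pa : p < a) (a1 : a < 1).
Local Notation pmf := (@bernoulli_pmf R p).

Definition cell_weight (j : {ffun cell d -> bool}) : R := \prod_c pmf (j c).

Let pmf_ge0 b : 0 <= pmf b.
Proof. by have /andP[p0 p1] := p01; case: b => /=; rewrite ?subr_ge0 ltW. Qed.

Lemma cell_weight_ge0 j : 0 <= cell_weight j.
Proof. exact: prodr_ge0. Qed.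

Lemma sum_cell_weight (K : cell d -> pred bool) :
  \sum_(j : {ffun cell d -> bool} | [forall c, K c (j c)]) cell_weight j =
  \prod_c \sum_(b | K c b) pmf b.
Proof.
by rewrite (bigA_distr_big_dep K (fun _ b => pmf b)).
Qed.

Lemma sum_pmf : \sum_b pmf b = 1.
Proof. by rewrite big_bool /=; ring. Qed.

Lemma sum_cell_weightT : \sum_(j : {ffun cell d -> bool}) cell_weight j = 1.
Proof.
rewrite /cell_weight -(bigA_distr_bigA (fun _ b => pmf b)) big1// => c _.
exact: sum_pmf.
Qed.

Definition rim_prob : R := \sum_(j : {ffun cell d -> bool} | all_rim j) cell_weight j.

Lemma rim_probE : rim_prob = p ^+ #|predC1 (middle d)|.
Proof.
rewrite /rim_prob (sum_cell_weight (fun c b => (c != middle d) ==> b)).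
rewrite (bigD1 (middle d))//= eqxx /= sum_pmf mul1r -prodr_const.
apply: eq_big => [c|c /negbTE cm]; first by rewrite inE.
by rewrite cm /= (big_pred1 true) => [|[]].
Qed.

Lemma rim_prob_gt0 : 0 < rim_prob.
Proof. by rewrite rim_probE exprn_gt0//; case/andP: p01. Qed.

Lemma rim_prob_le1 : rim_prob <= 1.
Proof. by have /andP[/ltW p0 /ltW p1] := p01; rewrite rim_probE exprn_ile1. Qed.

Lemma rim_middle_prob :
  \sum_(j : {ffun cell d -> bool} | all_rim j && j (middle d)) cell_weight j =
  p * rim_prob.
Proof.
rewrite rim_probE.
rewrite (eq_bigl (fun j : {ffun cell d -> bool} => [forall c, j c])); last first.
  move=> j; apply/andP/forallP => [[/forallP h jm] c|h].
    by have [->//|cm] := eqVneq c (middle d); have := h c; rewrite cm.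
  by split => //; apply/forallP => c; rewrite h implybT.
rewrite (sum_cell_weight (fun c b => b)) (bigD1 (middle d))//= -prodr_const.
congr (_ * _); first by rewrite (big_pred1 true) => [|[]].
apply: eq_big => [c|c cm]; first by rewrite inE.
by rewrite (big_pred1 true) => [|[]].
Qed.

Definition slack : R := rim_prob * (a - p) / 2.

(** With [j] the number of filled blocks and [m] the number of good ones, the sum
    of the scores over the explored blocks is [j - a * m + slack * |S|]; a set is
    unbalanced when this is positive. The slack is chosen to be half of what
    would make the mean score vanish, so that the mean is still negative. *)
Definition score (j : {ffun cell d -> bool}) : R :=
  (all_rim j && j (middle d))%:R - a * (all_rim j)%:R + slack.

Lemma slack_gt0 : 0 < slack.
Proof. by rewrite /slack divr_gt0// mulr_gt0 ?rim_prob_gt0// subr_gt0. Qed.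

Lemma slack_lt1 : slack < 1.
Proof.
have r0 := rim_prob_gt0; have r1 := rim_prob_le1.
move: p01 pa a1 => /andP[p0 p1] pa' a1'.
by rewrite /slack ltr_pdivrMr// mul1r; nra.
Qed.

Lemma mean_score : \sum_j cell_weight j * score j = - slack.
Proof.
rewrite /score; under eq_bigr do rewrite mulrDr mulrBr.
rewrite big_split sumrB /= -mulr_suml sum_cell_weightT mul1r.
have -> : \sum_j cell_weight j * (all_rim j && j (middle d))%:R = p * rim_prob.
  rewrite -rim_middle_prob [RHS]big_mkcond /=; apply: eq_bigr => j _.
  by case: (_ && _); rewrite ?mulr1 ?mulr0.
have -> : \sum_j cell_weight j * (a * (all_rim j)%:R) = a * rim_prob.
  rewrite /rim_prob mulr_sumr [RHS]big_mkcond /=; apply: eq_bigr => j _.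
  by case: (all_rim j); rewrite ?mulr1 ?mulr0// mulrC.
by rewrite /slack; field.
Qed.

Lemma score_bound j : `|score j| <= 2.
Proof.
have s0 := slack_gt0; have s1 := slack_lt1; move: p01 pa a1 => /andP[p0 p1] pa' a1'.
rewrite /score ler_norml.
by case: (all_rim j) => /=; [case: (j _)|]; rewrite /= ?mulr1 ?mulr0;
  apply/andP; split; lra.
Qed.

(** With second moment of the score at most 4, the bound
    [1 - tilt * slack + 8 * tilt ^+ 2] on the mean of the exponential weight is
    minimal at this value. *)
Definition tilt : R := slack / 16.

Definition partition_function : R := \sum_j cell_weight j * expR (tilt * score j).

Lemma partition_function_lt1 : partition_function < 1.
Proof.
have s0 := slack_gt0; have s1 := slack_lt1.
have t0 : 0 < tilt by rewrite /tilt; lra.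
have t1 : tilt <= 1 / 16 by rewrite /tilt; lra.
apply: (@le_lt_trans _ _ (\sum_j cell_weight j * (1 + tilt * score j + 8 * tilt ^+ 2))).
  apply: ler_sum => j _; rewrite ler_wpM2l ?cell_weight_ge0//.
  have sj := score_bound j.
  have u2 : `|tilt * score j| <= 2^-1.
    by rewrite normrM (gtr0_norm t0); have := normr_ge0 (score j); nra.
  apply: le_trans (expR_le_quadratic u2) _; rewrite lerD2l exprMn.
  have : score j ^+ 2 <= 4.
    by rewrite -(real_normK (num_real _)); have := normr_ge0 (score j); nra.
  by have := sqr_ge0 tilt; nra.
have -> : \sum_j cell_weight j * (1 + tilt * score j + 8 * tilt ^+ 2) =
   1 - tilt * slack + 8 * tilt ^+ 2.
  transitivity (\sum_j (cell_weight j + tilt * (cell_weight j * score j) +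
      8 * tilt ^+ 2 * cell_weight j)).
    by apply: eq_bigr => j _; ring.
  rewrite big_split big_split /= -[X in _ + X + _]mulr_sumr mean_score.
  by rewrite -mulr_sumr sum_cell_weightT; ring.
by rewrite /tilt expr2; nra.
Qed.

Lemma partition_function_gt0 : 0 < partition_function.
Proof.
rewrite /partition_function.
have : 0 < \sum_j cell_weight j * expR (- (2 * tilt)).
  by rewrite -mulr_suml sum_cell_weightT mul1r expR_gt0.
move=> /lt_le_trans; apply; apply: ler_sum => j _.
rewrite ler_wpM2l ?cell_weight_ge0// ler_expR.
have t0 : 0 < tilt by have := slack_gt0; rewrite /tilt; lra.
by have := score_bound j; rewrite ler_norml => /andP[h _]; nra.
Qed.

Definition site_weight (A : {fset site d}) (x : 'rV[int]_d) : R :=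
  if x \in closed_nbhd A then pmf (x \in A) else 1.

Lemma compatible_weight A v :
  \sum_(j | compatible A v j) cell_weight j = \prod_c site_weight A (position v c).
Proof.
rewrite (sum_cell_weight (fun c b =>
  (position v c \in closed_nbhd A) ==> (b == (position v c \in A)))).
apply: eq_bigr => c _; rewrite /site_weight; case: (_ \in closed_nbhd A) => /=.
  by rewrite (big_pred1 (position v c \in A)).
exact: sum_pmf.
Qed.

Definition tilted_weight j := cell_weight j * expR (tilt * score j) / partition_function.

Definition block_score (A : {fset site d}) v : R :=
  (v \in filled_blocks A)%:R - a * (v \in good_blocks A)%:R + slack.

(** The score is constant on the configurations of an explored block that are
    compatible with [A]. On the other blocks there is no prescription, and the
    tilted weights add up to 1 by the choice of the normalization. *)
Lemma compatible_tilted_weight A v : \sum_(j | compatible A v j) tilted_weight j =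
  (if v \in explored_blocks A
   then expR (tilt * block_score A v) / partition_function else 1) *
  \prod_c site_weight A (position v c).
Proof.
have Z0 := partition_function_gt0.
case: ifPn => vA.
  rewrite -compatible_weight mulr_sumr; apply: eq_bigr => j jA.
  rewrite /tilted_weight /score (compatible_filled d2 vA jA) (compatible_good d2 vA jA).
  by rewrite -/(block_score A v) [RHS]mulrC mulrA.
have off c : position v c \notin closed_nbhd A.
  apply: contra vA => cA; apply/imfsetP; exists (position v c) => //=.
  by rewrite block_position.
rewrite mul1r [RHS]big1 => [|c _]; last by rewrite /site_weight (negbTE (off c)).
rewrite (eq_bigl predT) => [|j]; last first.
  by apply/compatibleP => c; rewrite (negbTE (off c)).
by rewrite /tilted_weight -mulr_suml -/partition_function divff// gt_eqF.
Qed.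

Variable P : probability (config (site d)) R.
Hypothesis HP : is_bernoulli_product p P.

Lemma prod_site_weight (VB : {fset site d}) A : {subset explored_blocks A <= VB} ->
  \prod_(v <- VB) \prod_c site_weight A (position v c) = pr P (isolated_event A).
Proof.
move=> AVB; rewrite /pr HP /=.
pose s := [seq position v c | v <- VB, c <- index_enum (cell d)].
have us : uniq s.
  apply: allpairs_uniq; rewrite ?fset_uniq ?index_enum_uniq// => -[v c] [v' c'] _ _ /= e.
  have vv : v = v' by rewrite -(block_position v c) e block_position.
  by rewrite -vv in e *; rewrite (position_inj e).
transitivity (\prod_(x <- s) site_weight A x); first by rewrite big_allpairs_dep.
transitivity (\prod_(x <- s | x \in closed_nbhd A) site_weight A x).
  by rewrite [RHS]big_mkcond; apply: eq_bigr => x _; rewrite /site_weight; case: ifP.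
rewrite -big_filter; transitivity (\prod_(x <- closed_nbhd A) site_weight A x).
  apply: perm_big; apply: uniq_perm; rewrite ?filter_uniq ?fset_uniq// => x.
  rewrite mem_filter; have [xA|//] := boolP (x \in closed_nbhd A).
  rewrite andTb; have [c xc] := position_surj (erefl (block x)).
  apply/allpairsP; exists (block x, c); split => //=.
    by apply: AVB; apply/imfsetP; exists x.
  by rewrite mem_index_enum.
by apply: eq_big_seq => x xA; rewrite /site_weight xA.
Qed.

Lemma sum_block_score A : \sum_(v <- explored_blocks A) block_score A v =
  #|` filled_blocks A|%:R - a * #|` good_blocks A|%:R + slack * #|` explored_blocks A|%:R.
Proof.
have cnt D : {subset D <= explored_blocks A} ->
    \sum_(v <- explored_blocks A) (v \in D)%:R = #|` D|%:R :> R.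
  move=> DA; rewrite -(sum_fset_sub 1 DA) [RHS]big_mkcond /=.
  by apply: eq_bigr => v _; case: ifP.
rewrite /block_score big_split sumrB /= -mulr_sumr !cnt.
- by rewrite big_const_seq count_predT iter_addr_0 [slack * _]mulr_natr.
- exact: good_sub_explored.
- move=> v; rewrite filled_blocksE => /andP[gv _]; exact: good_sub_explored.
Qed.

Definition unbalanced (A : {fset site d}) : Prop :=
  a * #|` good_blocks A|%:R - slack * #|` explored_blocks A|%:R < #|` filled_blocks A|%:R.

(** The sets in [s] are connected and contain [x], so the corresponding events
    exclude each other, whatever the law of the blocks; hence their tilted
    probabilities add up to at most 1. The tilted probability of [A] is the
    original one times [expR (tilt * Y) / Z ^ |S|], where [Y >= 0] is the sum of
    the scores of the explored blocks [S] and [Z] the partition function. *)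
Lemma unbalanced_sum_le (s : seq {fset site d}) x n : uniq s ->
  (forall A, A \in s -> [/\ connected_fset A, x \in A, unbalanced A &
     (n <= #|` explored_blocks A|)%N]) ->
  \sum_(A <- s) pr P (isolated_event A) <= partition_function ^+ n.
Proof.
move=> us sP.
have Z0 := partition_function_gt0; have Z1 := partition_function_lt1.
pose VB : {fset site d} :=
  [fset v in flatten [seq enum_fset (explored_blocks A) | A <- s]]%fset.
have AVB A : A \in s -> {subset explored_blocks A <= VB}.
  by move=> As v vA; rewrite in_fset; apply/flatten_mapP; exists A.
have := @partial_assignment_sum R VB {ffun cell d -> bool} _ s
  (fun A (v : VB) => compatible A (val v)) tilted_weight _ _ us _.
have t0 j : 0 <= tilted_weight j.
  by rewrite divr_ge0 ?(ltW Z0)// mulr_ge0 ?expR_ge0 ?cell_weight_ge0.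
have t1 : \sum_j tilted_weight j = 1.
  by rewrite /tilted_weight -mulr_suml -/partition_function divff// gt_eqF.
move=> /(_ t0 t1) H.
have {H} : \sum_(A <- s) \prod_(v : VB)
    \sum_(j | compatible A (val v) j) tilted_weight j <= 1.
  apply: H => A B As Bs AB.
  have [cA xA _ _] := sP A As; have [cB xB _ _] := sP B Bs.
  have [y [yA yB yAB]] := connected_conflict cA cB xA xB AB.
  have yV : block y \in VB by apply: (AVB A As); apply/imfsetP; exists y.
  exists [` yV]%fset => j; apply/negP => /andP[/compatibleP jA /compatibleP jB].
  have [c yc] := position_surj (erefl (block y)).
  move: (jA c) (jB c); rewrite /= -yc => /(_ yA) eA /(_ yB) eB.
  by move: yAB; rewrite -eA -eB eqxx.
move=> H.
have : partition_function ^- n * \sum_(A <- s) pr P (isolated_event A) <= 1.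
  apply: le_trans H; rewrite mulr_sumr big_seq [leRHS]big_seq.
  apply: ler_sum => A As; have [cA xA uA nA] := sP A As.
  rewrite -(big_seq_fsetE _ VB predT
    (fun v => \sum_(j | compatible A v j) tilted_weight j)) /=.
  under eq_bigr do rewrite compatible_tilted_weight.
  rewrite big_split /= prod_site_weight; last exact: AVB.
  rewrite ler_wpM2r ?pr_ge0// -big_mkcond big_fset_condE.
  rewrite (_ : [fset v in VB | _]%fset = explored_blocks A); last first.
    apply/fsetP => v; rewrite !inE /=; apply/andP/idP => [[]//|vA].
    by split => //; have := AVB A As v vA; rewrite in_fset.
  rewrite big_split /= -expR_sum -mulr_sumr sum_block_score.
  rewrite big_const_seq count_predT iter_mulr_1 exprVn.
  apply: (@le_trans _ _ (partition_function ^- #|` explored_blocks A|)).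
    by rewrite lef_pV2 ?posrE ?exprn_gt0// ler_wiXn2l// ltW.
  rewrite ler_peMl ?invr_ge0 ?exprn_ge0 ?(ltW Z0)//.
  apply: le_trans (expR_ge1Dx _); rewrite lerDl mulr_ge0//.
    by rewrite /tilt divr_ge0// ltW// slack_gt0.
  by move: uA; rewrite /unbalanced; lra.
by rewrite ler_pdivrMl ?exprn_gt0// mulr1.
Qed.

End tilt.

(** * Sizes of order larger than log n carry no large atom *)

Lemma measurable_Cmax_eq d n k : (0 < k)%N ->
  measurable ([set w | Cmax n w = k] : set (config (site d))).
Proof.
move=> k0; rewrite (_ : [set _ | _] =
    [set w | (Cmax n w <= k)%N] `\` [set w | (Cmax n w <= k.-1)%N]).
  by apply: measurableD; exact: measurable_Cmax_le.
apply/seteqP; split => w /=; first by move=> ->; split => //; apply/negP; lia.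
by move=> [h /negP h']; lia.
Qed.

Section anticoncentration.
Variables (d : nat) (R : realType) (p a : R).
Hypotheses (d2 : (2 <= d)%N) (p01 : 0 < p < 1) (pa : p < a) (a1 : a < 1).
Variable P : probability (config (site d)) R.
Hypothesis HP : is_bernoulli_product p P.

(** The largest cluster is either unbalanced, an event bounded by a sum over the
    sites of the box it may contain, or typical. As at least [k %/ 3 ^ d] blocks are
    explored, being balanced provides the margin [slack * (k %/ 3 ^ d)]. *)
Lemma pr_Cmax_eq_le n k T : (0 < k)%N ->
  (0 < T)%N -> T%:R <= slack d p a * (k %/ 3 ^ d)%:R ->
  (a * (1 - p) / ((1 - a) * p)) ^+ T <= 2 ->
  pr P [set w | Cmax n w = k] <=
    2 / T%:R + #|` @boxf d n|%:R * partition_function d p a ^+ (k %/ 3 ^ d).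
Proof.
move=> k0 T0 Ts rT.
set K := (k %/ 3 ^ d)%N.
(* Restricting to clusters inside a large box makes all the sums finite. *)
pose F N : set (config (site d)) := [set w | Cmax n w = k] `&`
  \bigcup_(xA in [set xA : site d * {fset site d} |
      [/\ xA.1 \in boxf n, xA.1 \in xA.2, #|` xA.2| = k &
       {subset xA.2 <= boxf (3 * N + 1)}]]) [set w | cluster w xA.1 = [set` xA.2]].
have mF N : measurable (F N).
  apply: measurableI; first exact: measurable_Cmax_eq.
  rewrite bigcup_mkcond; apply: countable_bigcupT_measurable => // xA.
  by case: ifP => _; [exact: measurable_cluster_eq|exact: measurable0].
have -> : [set w : 'rV[int]_d -> bool | Cmax n w = k] = \bigcup_N F N.
  apply/seteqP; split => [w wk|w [N _ []//]].
  have /Cmax_attained[x [A [xn xA cA Ak]]] : (0 < Cmax n w)%N by rewrite wk.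
  have [N AN] := fset_in_boxf A.
  exists N => //; split => //; exists (x, A) => //=; split => //; first by rewrite Ak.
  by move=> y /AN; rewrite !in_boxf => h; lia.
apply: pr_bigcup_le => // N.
  move=> w [wk [[x A] /= [xn xA Ak AN] cA]]; split => //.
  exists (x, A) => //=; split => //.
  by move=> y /AN; rewrite !in_boxf => h; lia.
pose bad x := [seq A <- fpowerset (@boxf d (3 * N + 1)) |
  `[< [/\ connected_fset A, x \in A, unbalanced p a A & #|` A| = k] >]].
pose typ := @typical_sets d R a (slack d p a * K%:R) n k N 0.
pose idx := [seq (true, A) | x <- boxf n, A <- bad x] ++ [seq (false, A) | A <- typ].
pose G (bA : bool * {fset site d}) : set (config (site d)) :=
  if bA.1 then isolated_event bA.2 else isolated_event bA.2 `&` others_le n k bA.2.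
have mG bA : measurable (G bA).
  rewrite /G; case: bA.1; first exact: measurable_cylinder.
  by apply: measurableI; [exact: measurable_cylinder|exact: measurable_others].
apply: (@le_trans _ _ (\sum_(bA <- idx) pr P (G bA))).
  apply: pr_union_bound => // w [wk [[x A] /= [xn xA Ak AN] cA]].
  have conA := cluster_connected xA cA; have iA := cluster_isolated xA cA.
  have Afp : A \in fpowerset (@boxf d (3 * N + 1)) by rewrite fpowersetE; apply/fsubsetP.
  have [uA|bA] := pselect (unbalanced p a A).
    exists (true, A) => //; rewrite mem_cat; apply/orP; left.
    apply/allpairsPdep; exists x, A; split => //.
    by rewrite mem_filter Afp andbT; apply/asboolP.
  exists (false, A); last first.
    by split => //=; rewrite -wk; exact: Cmax_others cA.
  rewrite mem_cat; apply/orP; right; apply/mapP; exists A => //.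
  apply/typical_setsP; split => //; split => //; first by exists x.
    by rewrite addn0.
  have KA : K%:R <= #|` explored_blocks A|%:R :> R.
    rewrite ler_nat /K -Ak; have := card_fset_explored A.
    have d0 : (0 < 3 ^ d)%N by rewrite expn_gt0.
    by move=> /(leq_div2r (3 ^ d)); rewrite mulnK.
  have s0 := slack_gt0 d p01 pa.
  move/negP: bA; rewrite /unbalanced -leNgt => bA; rewrite addr0.
  by apply: le_trans bA _; rewrite lerD2l lerN2 ler_wpM2l// ltW.
rewrite big_cat /= big_allpairs_dep big_map /= addrC lerD//.
  rewrite ler_pdivlMr ?ltr0n//.
  exact: (typical_mass0_le d2 p01 HP (ltW pa) a1).
apply: (@le_trans _ _ (\sum_(x <- @boxf d n) partition_function d p a ^+ K)).
  apply: ler_sum => x _; rewrite /G /=.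
  apply: (unbalanced_sum_le d2 p01 pa a1 HP (x := x)).
    by apply: filter_uniq; exact: fset_uniq.
  move=> A; rewrite mem_filter => /andP[/asboolP[cA xA uA Ak] _]; split => //.
  rewrite /K -Ak; have := card_fset_explored A.
  have d0 : (0 < 3 ^ d)%N by rewrite expn_gt0.
  by move=> /(leq_div2r (3 ^ d)); rewrite mulnK.
by rewrite big_const_seq count_predT iter_addr_0 mulr_natl.
Qed.

End anticoncentration.

(** * Producing a large finite cluster in a box *)

Section translation.
Variable d : nat.
Implicit Types (x y z : 'rV[int]_d) (w : 'rV[int]_d -> bool).

Definition shift z w : 'rV[int]_d -> bool := fun y => w (y + z).

Lemma cluster_shift_sub z w x y :
  cluster (shift z w) x y -> cluster w (x + z) (y + z).
Proof.
move=> xy.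
apply: (@cluster_ind _ (shift z w) x (fun y => cluster w (x + z) (y + z))) (xy).
  apply: cluster_refl; exact: (cluster_source xy).
by move=> a b xa _ wb ab; apply: cluster_step xa _ wb; rewrite adjacentDr.
Qed.

Lemma cluster_shift z w x y :
  cluster w (x + z) y <-> cluster (shift z w) x (y - z).
Proof.
split=> [h|/cluster_shift_sub]; last by rewrite subrK.
have e : w = shift (- z) (shift z w).
  by apply/funext => u; rewrite /shift subrK.
by rewrite e in h; have := cluster_shift_sub h; rewrite addrK.
Qed.

Lemma cluster_shift_fset z w x (A : {fset site d}) :
  cluster (shift z w) x = [set` A] ->
  cluster w (x + z) = [set` [fset (y + z)%R | y in A]%fset].
Proof.
move=> cA; apply/seteqP; split => y /=.
  move=> /cluster_shift; rewrite cA /= => yA.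
  by apply/imfsetP; exists (y - z) => //; rewrite subrK.
move=> /imfsetP[u /= uA ->]; apply/cluster_shift; by rewrite addrK cA.
Qed.

End translation.

Section touching.
Variable d : nat.
Implicit Types (x y z : 'rV[int]_d) (w : 'rV[int]_d -> bool) (L m : nat).

Definition restrict L w : 'rV[int]_d -> bool := fun z => (sup_norm z <= L)%N && w z.

(** Connection inside the box, so that the event does not depend on the shells
    added around it. *)
Definition touches L x : set (config (site d)) :=
  [set w | exists2 y, sup_norm y = L & cluster (restrict L w) x y].

Lemma touches_depends L x : depends_on (mem (@boxf d L)) (touches L x).
Proof.
move=> w w' ww' [y yL xy]; exists y => //.
rewrite (_ : restrict L w' = restrict L w)//; apply/funext => u; rewrite /restrict.
by case: leqP => //= uL; rewrite ww'//= in_boxf.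
Qed.

Lemma measurable_touches L x : measurable (touches L x).
Proof. exact: measurable_local (touches_depends (L := L) (x := x)). Qed.

(** If the part of the cluster reached inside the box stays away from its
    boundary, then it is the whole cluster. *)
Lemma touches_of_infinite L x w : (sup_norm x <= L)%N ->
  infinite_set (cluster w x) -> touches L x w.
Proof.
move=> xL inf; apply: contrapT => nt; apply: inf.
apply: sub_finite_set (finite_sup_norm_le d L) => y xy.
suff : cluster (restrict L w) x y by move=> /cluster_occupied /andP[].
apply: (@cluster_ind _ w x (cluster (restrict L w) x)) (xy).
  by apply: cluster_refl; rewrite /restrict xL; exact: cluster_source xy.
move=> a b xa _ wb ab; apply: (cluster_step xa ab); rewrite /restrict wb andbT.
have /andP[aL _] := cluster_occupied xa.
have aL' : sup_norm a != L by apply/eqP => e; apply: nt; exists a.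
by have := sup_norm_adjacent ab; lia.
Qed.

Definition many_touching L m : set (config (site d)) :=
  [set w | (m <= count (fun x => `[< touches L x w >]) (boxf L))%N].

Lemma many_touching_depends L m : depends_on (mem (@boxf d L)) (many_touching L m).
Proof.
move=> w w' ww'; rewrite /many_touching /= => /leq_trans; apply.
apply: sub_count => x /asboolP h; apply/asboolP; exact: touches_depends h.
Qed.

Definition frame L : {fset site d} := (boxf (L + 2) `\` boxf L)%fset.

(** In the frame, the inner shell is occupied and the outer one is vacant. *)
Definition success L m : set (config (site d)) :=
  many_touching L m `&` cylinder (frame L) (fun x => (sup_norm x <= L + 1)%N).

Definition corner L : 'rV[int]_d := const_mx (L + 1)%N%:Z.

Hypothesis d2 : (2 <= d)%N.

Lemma sup_norm_corner L : sup_norm (corner L) = (L + 1)%N.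
Proof.
have d0 : (0 < d)%N by lia.
by apply: (@sup_norm_eq _ _ (Ordinal d0)) => [i|]; rewrite mxE.
Qed.

(** The occupied shell is connected and catches every site that touches the
    boundary of the box; the vacant shell confines the cluster. *)
Lemma success_cluster L m w : success L m w -> exists2 A : {fset site d},
  cluster w (corner L) = [set` A] & (m <= #|` A|)%N.
Proof.
move=> [mw fw].
have w1 x : sup_norm x = (L + 1)%N -> w x.
  move=> xL; rewrite fw ?xL// !inE !in_boxf xL; lia.
have w2 x : sup_norm x = (L + 2)%N -> ~~ w x.
  move=> xL; rewrite fw ?xL; first by lia.
  by rewrite !inE !in_boxf xL; lia.
have cc : cluster w (corner L) (corner L).
  by apply: cluster_refl; apply: w1; exact: sup_norm_corner.
have cs z : sup_norm z = (L + 1)%N -> cluster w (corner L) z.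
  move=> zL; pose B := cluster w (corner L).
  apply: (@shell_connected _ (L + 1) B (corner L) z d2) => //.
    by move=> a b aL bL ab ca; apply: cluster_step ca ab _; exact: w1.
  exact: sup_norm_corner.
have fin : finite_set (cluster w (corner L)).
  apply: sub_finite_set (finite_sup_norm_le d (L + 1)) => y cy.
  apply: (@cluster_ind _ w (corner L) (fun y => (sup_norm y <= L + 1)%N)) (cy).
    by rewrite sup_norm_corner.
  move=> a b aL _ wb ab; have := sup_norm_adjacent ab.
  have [/w2|] := eqVneq (sup_norm b) (L + 2)%N; last by lia.
  by rewrite wb.
have /finite_fsetP[A cA] := fin; exists A => //.
apply: (leq_trans mw); rewrite -size_filter; apply: uniq_leq_size.
  by apply: filter_uniq; exact: fset_uniq.
move=> x; rewrite mem_filter => /andP[/asboolP[y yL xy] _].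
have cxy : cluster w x y by apply: cluster_mono xy => u /andP[].
suff : cluster w (corner L) y.
  by move=> /cluster_trans/(_ (cluster_sym cxy)); rewrite cA.
have [i yi] := sup_norm_attained y (ltnW d2).
pose b := if 0 <= y 0 i then y 0 i + 1 else y 0 i - 1.
have yb : adjacent y (upd y i b).
  by apply: adjacent_upd; rewrite /b; move: (y 0 i) => c; case: ifP; lia.
apply: (@cluster_step _ w _ (upd y i b)).
- apply: cs; apply: (@sup_norm_eq _ _ i) => [j|]; rewrite mxE.
    case: eqP => [_|_].
      by move: yi; rewrite yL /b; move: (y 0 i) => c; case: ifP; lia.
    by have := le_sup_norm y j; lia.
  by rewrite eqxx; move: yi; rewrite yL /b; move: (y 0 i) => c; case: ifP; lia.
- by rewrite adjacentC.
- exact: cluster_occupied cxy.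
Qed.

Lemma success_depends L m : depends_on (mem (@boxf d (L + 2))) (success L m).
Proof.
move=> w w' ww' [mw fw]; split.
  apply: many_touching_depends mw => x xL; apply: ww'.
  by move: xL; rewrite !inE !in_boxf; lia.
by move=> x xU; rewrite -fw// ww'//; move: xU; rewrite inE => /andP[].
Qed.

Definition shifted_success L m z : set (config (site d)) :=
  [set w | success L m (shift z w)].

Lemma shifted_success_depends L m z :
  depends_on [pred x | (sup_norm (x - z) <= L + 2)%N] (shifted_success L m z).
Proof.
move=> w w' ww'; apply: success_depends => x xL.
by rewrite /shift ww'// inE /= addrK -in_boxf.
Qed.

Lemma measurable_shifted_success L m z : measurable (shifted_success L m z).
Proof.
apply: (@measurable_local _ [fset (x + z)%R | x in boxf (L + 2)]%fset) => w w' ww'.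
apply: shifted_success_depends => x; rewrite inE => xL; apply: ww'.
by apply/imfsetP; exists (x - z) => /=; rewrite ?subrK// in_boxf.
Qed.

Lemma shifted_success_Cmax L m z n w : (corner L + z)%R \in boxf n ->
  shifted_success L m z w -> (m <= Cmax n w)%N.
Proof.
move=> zn /success_cluster[A cA mA].
have /Cmax_leP/(_ _ zn) h := leqnn (Cmax n w).
apply: leq_trans (h _ (cluster_shift_fset cA)).
by rewrite card_imfset//; exact: addIr.
Qed.

(** Translations along the first axis by multiples of the side [2 * L + 5] of the
    box with its two shells, so that the translated boxes are disjoint. *)
Definition row_shift L (i : nat) : 'rV[int]_d :=
  \row_j (if (j : nat) == 0%N then (i * (2 * L + 5))%N%:Z else 0).

Section probabilities.
Variables (R : realType) (p : R) (P : probability (config (site d)) R).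
Hypotheses (p01 : 0 < p < 1) (HP : is_bernoulli_product p P).

Let theta := pr P [set w | infinite_set (cluster w 0)].

Lemma pr_touches L x : (sup_norm x <= L)%N -> theta <= pr P (touches L x).
Proof.
move=> xL.
have mI := @measurable_infinite_cluster d 0.
have := bernoulli_product_reindex HP (s := fun y : site d => y + x) (@addIr _ x) mI.
rewrite /theta /pr => <-; apply: le_pr.
- have := @measurable_fun_config _ (config (site d)) (site d) (fun w y => w (y + x)).
  move=> /(_ (fun y => measurable_site _))/(_ measurableT _ mI).
  by rewrite setTI.
- exact: measurable_touches.
- move=> w /= inf; apply: touches_of_infinite => // fin; apply: inf.
  have /finite_fsetP[A cA] := fin.
  apply: (@sub_finite_set _ _ [set` [fset (y - x)%R | y in A]%fset]); last first.
    exact: finite_fset.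
  move=> y /(@cluster_shift_sub _ x w 0 y); rewrite add0r cA /= => yA.
  by apply/imfsetP; exists (y + x) => //; rewrite addrK.
Qed.

(** The mean number of touching sites is at least [theta] times the number of
    sites; it is at most [m] plus the number of sites times the probability
    that there are at least [m] of them. *)
Lemma pr_many_touching L m :
  theta * #|` @boxf d L|%:R <= m%:R + #|` @boxf d L|%:R * pr P (many_touching L m).
Proof.
have mM : measurable (many_touching L m).
  exact: measurable_local (many_touching_depends (L := L) (m := m)).
apply: (@le_trans _ _ (\sum_(x <- @boxf d L) pr P (touches L x))).
  have -> : theta * #|` @boxf d L|%:R = \sum_(x <- @boxf d L) theta.
    by rewrite big_const_seq count_predT iter_addr_0 mulr_natr.
  rewrite big_seq [leRHS]big_seq; apply: ler_sum => x; rewrite in_boxf.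
  exact: pr_touches.
apply: (@le_trans _ _ (\sum_(x <- @boxf d L)
   (pr P (touches L x `\` many_touching L m) + pr P (many_touching L m)))).
  apply: ler_sum => x _.
  have mT := measurable_touches L x.
  apply: le_trans (pr_setU_le _ _ mM); last exact: measurableD.
  apply: le_pr => //; first by apply: measurableU => //; exact: measurableD.
  by move=> w tw; have [] := pselect (many_touching L m w); [right|left].
rewrite big_split /= lerD//.
  apply: pr_sum_overlap_le => [x _|w].
    by apply: measurableD => //; exact: measurable_touches.
  have [mw|mw] := pselect (many_touching L m w).
    rewrite (eq_count (a2 := pred0)) ?count_pred0// => x /=.
    by apply/asboolP => -[].
  apply: (@leq_trans (count (fun x => `[< touches L x w >]) (boxf L))).
    by apply: sub_count => x /asboolP[tx _]; apply/asboolP.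
  by move: mw => /negP; rewrite -ltnNge => /ltnW.
by rewrite big_const_seq count_predT iter_addr_0 mulr_natl.
Qed.

Lemma pr_success L m (q : R) : 0 <= q -> q <= p -> q <= 1 - p ->
  pr P (many_touching L m) * q ^+ #|` frame L| <= pr P (success L m).
Proof.
move=> q0 qp qp1.
have mM : measurable (many_touching L m).
  exact: measurable_local (many_touching_depends (L := L) (m := m)).
have mC := @measurable_cylinder (site d) (frame L) (fun x => (sup_norm x <= L + 1)%N).
rewrite /success /pr (independence HP (U := mem (@boxf d L))) //; last 2 first.
- exact: many_touching_depends.
- move=> w w' ww' fw x xF; rewrite -ww' ?fw//.
  by move: xF; rewrite !inE /= => /andP[].
rewrite (prE P mM) (prE P mC) -EFinM /= ler_wpM2l ?pr_ge0//.
rewrite /pr HP /=.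
have -> : q ^+ #|` frame L| = \prod_(x <- frame L) q.
  by rewrite big_const_seq count_predT iter_mulr_1.
by apply: ler_prod => x _; rewrite q0 /bernoulli_pmf; case: ifP.
Qed.

Lemma pr_shifted_success L m z : pr P (shifted_success L m z) = pr P (success L m).
Proof.
have mS : measurable (success L m).
  exact: measurable_local (success_depends (L := L) (m := m)).
have := bernoulli_product_reindex HP (s := fun y : site d => y + z) (@addIr _ z) mS.
by rewrite /pr => <-.
Qed.

Definition no_success L m r : set (config (site d)) :=
  [set w | forall i, (i < r)%N -> ~ shifted_success L m (row_shift L i) w].

Lemma pr_no_success L m r : measurable (no_success L m r) /\
  pr P (no_success L m r) = (1 - pr P (success L m)) ^+ r.
Proof.
elim: r => [|r [mr IHr]].
  rewrite (_ : no_success L m 0 = setT); last by apply/seteqP; split.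
  by split => //; rewrite /pr probability_setT expr0.
have e : no_success L m r.+1 =
    ~` shifted_success L m (row_shift L r) `&` no_success L m r.
  apply/seteqP; split => w /=.
    by move=> h; split => [|i ir]; apply: h => //; exact: ltnW.
  by move=> [h0 h] i; rewrite ltnS leq_eqVlt => /orP[/eqP->//|]; exact: h.
have mS := measurable_shifted_success L m (row_shift L r).
rewrite e; split; first by apply: measurableI => //; exact: measurableC.
rewrite /pr.
rewrite (independence HP
  (U := [pred x | (sup_norm (x - row_shift L r) <= L + 2)%N])) //.
- rewrite (prE P mr) (prE P (measurableC mS)) -EFinM /= IHr pr_setC//.
  by rewrite pr_shifted_success exprS.
- exact: measurableC.
- move=> w w' ww' h h'; apply: h; apply: shifted_success_depends h' => x xU.
  by rewrite ww'.
- move=> w w' ww' h i ir h'; apply: (h i ir); apply: shifted_success_depends h' => x.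
  rewrite inE => /sup_norm_leP xi; rewrite ww'// inE /=; apply/negP => /sup_norm_leP xr.
  have d0 : (0 < d)%N by lia.
  have := xi (Ordinal d0); have := xr (Ordinal d0); rewrite !mxE /=.
  move: (x 0 _) => c; nia.
Qed.

Lemma pr_Cmax_small L m n r k : (k < m)%N -> (r * (2 * L + 5) <= n)%N ->
  pr P [set w | (Cmax n w <= k)%N] <= (1 - pr P (success L m)) ^+ r.
Proof.
move=> km rn; have [mN <-] := pr_no_success L m r.
apply: le_pr => //; first exact: measurable_Cmax_le.
move=> w /= Ck i ir /shifted_success_Cmax; move=> /(_ n) h.
suff /h : (corner L + row_shift L i)%R \in boxf n by lia.
rewrite in_boxf; apply/sup_norm_leP => j; rewrite !mxE; case: ifP => _; nia.
Qed.

End probabilities.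
End touching.

(** * The largest finite cluster exceeds every multiple of log n *)

Lemma card_boxf d L : #|` @boxf d L| = ((2 * L + 1) ^ d)%N.
Proof.
rewrite addn1.
pose f (g : {ffun 'I_d -> 'I_(2 * L).+1}) : site d := \row_i ((g i : nat)%:Z - L%:Z).
have finj : injective f.
  move=> g h /rowP gh; apply/ffunP => i; apply/val_inj; have := gh i; rewrite !mxE /=.
  by move: (nat_of_ord (g i)) (nat_of_ord (h i)) => a b; lia.
transitivity #|{ffun 'I_d -> 'I_(2 * L).+1}|; last by rewrite card_ffun !card_ord.
rewrite cardE -(size_map f); apply/perm_size/uniq_perm => [||x].
- exact: fset_uniq.
- by rewrite (map_inj_uniq finj); exact: enum_uniq.
rewrite in_boxf; apply/sup_norm_leP/mapP => [h|[g _ ->] i]; last first.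
  by rewrite mxE; have := ltn_ord (g i); move: (nat_of_ord (g i)) => a; lia.
exists [ffun i => inord `|(x 0 i + L%:Z)%R|%N]; first by rewrite mem_enum.
apply/rowP => i; rewrite !mxE ffunE.
have := h i; move: (x 0 i) => c hc.
by rewrite inordK; lia.
Qed.

Lemma expn_add4_le a d : ((a + 4) ^ d <= a ^ d + 4 * d * (a + 4) ^ d.-1)%N.
Proof.
elim: d => [|d IHd]; first by rewrite !expn0.
rewrite /= !expnS; case: d IHd => [|d] /= IHd; first by rewrite !expn0; lia.
have := leq_mul (leqnn a) IHd; rewrite !expnS.
move: (_ ^ d)%N ((a + 4) ^ d)%N => A B; nia.
Qed.

(** Only the exponent [d.-1] matters: the two shells are negligible with respect
    to the volume of the box. *)
Lemma card_frame d L : (1 < d)%N -> (0 < L)%N ->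
  (#|` frame d L| <= 4 * d * 7 ^ d.-1 * L ^ d.-1)%N.
Proof.
move=> d1 L0; rewrite /frame cardfsD.
rewrite (fsetIidPr _); last by apply/fsubsetP => x; rewrite !in_boxf; lia.
rewrite !card_boxf.
have := expn_add4_le (2 * L + 1) d.
rewrite (_ : 2 * L + 1 + 4 = 2 * (L + 2) + 1)%N; last by lia.
have : (4 * d * (2 * (L + 2) + 1) ^ d.-1 <= 4 * d * 7 ^ d.-1 * L ^ d.-1)%N.
  by rewrite -[leqRHS]mulnA -expnMn leq_mul// leq_exp2r; lia.
by lia.
Qed.

Lemma exists_scale D e l L0 : (0 < D)%N -> (0 < e)%N -> (D * L0 ^ e <= l)%N ->
  exists L, [/\ (L0 <= L)%N, (D * L ^ e <= l)%N & (l < D * L.+1 ^ e)%N].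
Proof.
move=> D0 e0 h0.
have ub L : (D * L ^ e <= l)%N -> (L <= l)%N.
  apply: leq_trans; apply: (@leq_trans (L ^ e)); last by rewrite leq_pmull.
  by case: L => [//|L]; rewrite -{1}(expn1 L.+1) leq_pexp2l.
have ex : exists L, (D * L ^ e <= l)%N by exists L0.
case: (ex_maxnP ex ub) => L hL maxL; exists L; split => //; first exact: maxL.
by rewrite ltnNge; apply/negP => /maxL; rewrite ltnn.
Qed.

Lemma sqr_le_expn2 h : (4 <= h)%N -> (h * h <= 2 ^ h)%N.
Proof.
elim: h => [//|h IHh]; rewrite leq_eqVlt => /orP[/eqP<-//|h4].
by have := IHh h4; rewrite expnS; nia.
Qed.

Lemma expn2_growth X h : (9 * X + 4 <= h)%N -> (X * (4 * h + 5) <= 2 ^ h)%N.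
Proof.
move=> hX; have : (4 <= h)%N by lia.
by move=> /sqr_le_expn2; apply: leq_trans; nia.
Qed.

Lemma exists_expr_small (R : realType) (z y : R) : 0 <= z -> z < 1 -> 0 < y ->
  exists c : nat, (0 < c)%N /\ z ^+ c <= y.
Proof.
move=> z0 z1 y0.
have := @cvg_expr R z; rewrite ger0_norm// => /(_ z1) /cvgrPdist_le /(_ y y0) [c _ hc].
exists c.+1; split => //; have := hc c.+1 (leqnSn c).
by rewrite sub0r normrN ger0_norm// exprn_ge0.
Qed.

Section large_Cmax.
Variables (d : nat) (R : realType) (p : R) (P : probability (config (site d)) R).
Hypotheses (d2 : (2 <= d)%N) (p01 : 0 < p < 1) (HP : is_bernoulli_product p P).
Hypothesis theta_gt0 :
  0 < pr P [set w : 'rV[int]_d -> bool | infinite_set (cluster w 0)].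

(** Let [l] be the integer part of the binary logarithm of [n]. The size [L] is
    the largest one for which the bound on the number of sites of the frame
    keeps its cost within a factor [2 ^ (l / 2)]; then
    [L ^ d.-1] is of order [l], so [L ^ d] exceeds every multiple of [l], and
    [X * 2 ^ (l / 2)] boxes fit on an axis and suffice. *)
Lemma pr_Cmax_log_small (M : nat) (eps : R) : 0 < eps ->
  exists n0, forall n, (n0 <= n)%N ->
  pr P [set w | (Cmax n w <= M * trunc_log 2 n)%N] <= eps.
Proof.
move=> eps0; have t0 := theta_gt0; set theta := pr P _ in t0.
have e0 : (0 < d.-1)%N by rewrite -subn1 subn_gt0.
have [b [b0 bq]] : exists b : nat, (0 < b)%N /\ (2^-1 : R) ^+ b <= Num.min p (1 - p).
  have min0 : 0 < Num.min p (1 - p).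
    by rewrite lt_min subr_gt0; have /andP[-> ->] := p01.
  have h1 : (2^-1 : R) < 1 by rewrite invf_lt1 ?ltr1n.
  by apply: exists_expr_small h1 min0; rewrite invr_ge0.
move: bq; rewrite le_min => /andP[bp bp1].
pose C := (4 * d * 7 ^ d.-1)%N.
have C0 : (0 < C)%N by rewrite /C !muln_gt0 expn_gt0 /= (ltnW d2).
pose D := (2 * (b * C))%N.
have D0 : (0 < D)%N by rewrite /D muln_gt0 /= muln_gt0 b0.
(* From [L >= L0] it follows that [theta * L ^ d] is at least [2 * m]. *)
pose B := (2 * M.+1 * D * 2 ^ d.-1)%N.
pose L0 := (Num.bound (B%:R / theta)).+1.
have L0B : B%:R <= theta * L0%:R.
  rewrite mulrC -ler_pdivrMr//; apply: ltW; apply: (lt_trans (archi_boundP _)).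
    by rewrite divr_ge0// ltW.
  by rewrite ltr_nat.
pose X := Num.bound (2 / (theta * eps)).
have XE : eps^-1 <= X%:R * (theta / 2).
  have : 2 / (theta * eps) < X%:R.
    by apply: archi_boundP; rewrite divr_ge0// ltW// mulr_gt0.
  rewrite ltr_pdivrMr ?mulr_gt0// => /ltW h.
  by rewrite -div1r ler_pdivrMr//; move: h; nra.
pose l0 := (D * L0 ^ d.-1 + 2 * (9 * X + 4) + 1)%N.
exists (2 ^ l0)%N => n nl0.
have n0 : (0 < n)%N by apply: leq_trans nl0; rewrite expn_gt0.
set l := trunc_log 2 n.
have l0l : (l0 <= l)%N by exact: trunc_log_max.
have ln : (2 ^ l <= n)%N by exact: trunc_logP.
have [L [LL0 DL LD]] : exists L,
    [/\ (L0 <= L)%N, (D * L ^ d.-1 <= l)%N & (l < D * L.+1 ^ d.-1)%N].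
  by apply: exists_scale => //; move: l0l; rewrite /l0; clear; lia.
have L1 : (0 < L)%N by apply: leq_trans LL0.
have Ll : (L <= l)%N.
  apply: leq_trans DL; apply: (@leq_trans (L ^ d.-1)); last by rewrite leq_pmull.
  by rewrite -{1}(expn1 L) leq_pexp2l.
pose m := (M * l).+1.
have manyE : theta / 2 <= pr P (many_touching L m).
  have := pr_many_touching HP L m; rewrite -/theta card_boxf.
  set V := (2 * L + 1)%N.
  have mV : m%:R <= theta / 2 * (V ^ d)%:R.
    have h1 : (2 * m <= B * L ^ d.-1)%N.
      rewrite /B /m.
      apply: (@leq_trans (2 * M.+1 * (D * L.+1 ^ d.-1))).
        move: l0l LD; rewrite /l0; move: (D * L.+1 ^ _)%N (D * L0 ^ _)%N => u v.
        by clear; nia.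
      rewrite -[leqRHS]mulnA -expnMn -[leqRHS]mulnA leq_mul// leq_mul// leq_exp2r//.
      by move: L1; clear; lia.
    have h2 : B%:R * (L ^ d.-1)%:R <= theta * (V ^ d)%:R.
      apply: (@le_trans _ _ (theta * L%:R * (L ^ d.-1)%:R)).
        rewrite ler_wpM2r//; apply: le_trans L0B _.
        by rewrite ler_wpM2l ?ler_nat// ltW.
      rewrite -mulrA; apply: ler_wpM2l; first exact: ltW.
      rewrite -natrM ler_nat -expnS (prednK (ltnW d2)).
      by rewrite leq_exp2r ?(ltnW d2)// /V; clear; lia.
    have : (2 * m)%:R <= theta * (V ^ d)%:R.
      by apply: le_trans h2; rewrite -natrM ler_nat.
    by rewrite natrM; lra.
  have V0 : 0 < (V ^ d)%:R :> R by rewrite ltr0n expn_gt0 /V addn1.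
  move=> h.
  have : theta / 2 * (V ^ d)%:R <= pr P (many_touching L m) * (V ^ d)%:R by nra.
  by rewrite ler_pM2r.
set s := pr P (success L m).
have sE : theta / 2 * (2^-1) ^+ l./2 <= s.
  have q0 : 0 <= (2^-1 : R) ^+ b by rewrite exprn_ge0// invr_ge0.
  apply: le_trans (pr_success HP L m q0 bp bp1).
  apply: ler_pM manyE _; [by rewrite divr_ge0// ltW| |].
    by rewrite exprn_ge0// invr_ge0.
  rewrite -exprM ler_wiXn2l ?invr_ge0 ?invf_le1 ?ler1n//.
  have : (b * #|` frame d L| <= b * (C * L ^ d.-1))%N by rewrite leq_mul// card_frame.
  by move: DL; rewrite /D; move: (L ^ d.-1)%N (#|` _|) b0; clear; move=> u v; nia.
pose r := (X * 2 ^ l./2)%N.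
have rn : (r * (2 * L + 5) <= n)%N.
  apply: leq_trans ln; have e : (l = l./2 + (l - l./2))%N by clear; lia.
  rewrite [in leqRHS]e expnD /r [(X * _)%N]mulnC -mulnA leq_mul//.
  apply: leq_trans (expn2_growth (X := X) (h := (l - l./2)%N) _).
    by rewrite leq_mul//; move: Ll; clear; lia.
  by move: l0l; rewrite /l0; clear; lia.
apply: le_trans (pr_Cmax_small d2 p01 HP (m := m) (ltnSn _) rn) _; rewrite -/s.
have rs : eps^-1 <= r%:R * s.
  apply: le_trans XE _; rewrite /r natrM -mulrA ler_wpM2l//.
  apply: le_trans (ler_wpM2l _ sE) => //.
  by rewrite mulrCA natrX -exprMn divff// expr1n mulr1.
have mS : measurable (@success d L m).
  exact: measurable_local (success_depends d2 (L := L) (m := m)).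
have s1 : s <= 1 by exact: pr_le1.
apply: (@le_trans _ _ (expR (- s) ^+ r)).
  by rewrite lerXn2r ?nnegrE ?subr_ge0 ?expR_ge0//; have := expR_ge1Dx (- s).
rewrite -expRM_natl mulrN expRN -[leRHS]invrK lef_pV2 ?posrE ?expR_gt0 ?invr_gt0//.
by apply: le_trans rs _; apply: le_trans (expR_ge1Dx _); rewrite lerDr.
Qed.

End large_Cmax.

(** * Convergence at the quantiles *)

(** Solve for [a] the equation that the odds ratio be [1 + 1 / (2 T)], and use
    [(1 + 1 / (2 T)) ^ T <= expR (1 / 2) <= 2]. *)
Lemma exists_odds_ratio (R : realType) (p : R) (T : nat) : 0 < p < 1 -> (0 < T)%N ->
  exists a, [/\ p < a, a < 1 & (a * (1 - p) / ((1 - a) * p)) ^+ T <= 2].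
Proof.
move=> /andP[p0 p1] T0.
have t0 : 0 < T%:R :> R by rewrite ltr0n.
pose h : R := (2 * T%:R)^-1.
have h0 : 0 < h by rewrite invr_gt0 mulr_gt0.
pose a := (1 + h) * p / (1 + h * p).
have e0 : 0 < 1 + h * p by rewrite addr_gt0// mulr_gt0.
exists a; split.
- rewrite /a ltr_pdivlMr//.
  have : 0 < h * p * (1 - p) by rewrite !mulr_gt0// subr_gt0.
  by nra.
- by rewrite /a ltr_pdivrMr//; nra.
have -> : a * (1 - p) / ((1 - a) * p) = 1 + h.
  rewrite /a; field; rewrite (gt_eqF e0) (gt_eqF p0) /=.
  have -> : 1 + h * p - (1 + h) * p = 1 - p by ring.
  by rewrite gt_eqF// subr_gt0.
apply: (@le_trans _ _ (expR h ^+ T)).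
  apply: lerXn2r; rewrite ?nnegrE ?expR_ge0//; last exact: expR_ge1Dx.
  by rewrite addr_ge0// ltW.
rewrite -expRM_natl.
have -> : T%:R * h = 2^-1 by rewrite /h; field; rewrite gt_eqF.
rewrite -[X in expR X]opprK expRN -[leRHS]invrK lef_pV2 ?posrE ?expR_gt0//.
by apply: le_trans (expR_ge1Dx _); lra.
Qed.

Section assembly.
Variables (d : nat) (R : realType) (p : R) (P : probability (config (site d)) R).
Hypotheses (d2 : (2 <= d)%N) (p01 : 0 < p < 1) (HP : is_bernoulli_product p P).

(** With [T] of order [1 / eps], the first term of [pr_Cmax_eq_le] is at most half
    of [eps]. In the second one, [c] is chosen such that a size above
    [c * 3 ^ d * log n] beats the volume of the box, of order [n ^ d]. *)
Lemma pr_Cmax_atom_small (eps : R) : 0 < eps -> exists M n0, forall n k,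
  (n0 <= n)%N -> (M * trunc_log 2 n < k)%N -> pr P [set w | Cmax n w = k] <= eps.
Proof.
move=> eps0.
pose T := (Num.bound (4 / eps)).+1.
have Teps : 2 / T%:R <= eps / 2.
  have : 4 / eps < T%:R.
    apply: (lt_trans (archi_boundP _)); first by rewrite divr_ge0// ltW.
    by rewrite ltr_nat.
  rewrite ltr_pdivrMr// ler_pdivrMr ?ltr0n//; lra.
have [a [pa a1 rT]] := exists_odds_ratio p01 (ltn0Sn _ : (0 < T)%N).
set eta := slack d p a; set Z := partition_function d p a.
have eta0 : 0 < eta := slack_gt0 d p01 pa.
have Z0 : 0 < Z := partition_function_gt0 d p01 pa a1.
have Z1 : Z < 1 := partition_function_lt1 d p01 pa a1.
have [c [c0 Zc]] : exists c : nat, (0 < c)%N /\ Z ^+ c <= (2^-1) ^+ d.+1.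
  by apply: exists_expr_small Z1 _; [exact: ltW|rewrite exprn_gt0].
pose K0 := Num.bound (T%:R / eta).
pose E0 := Num.bound ((4 ^+ d) * 2 / eps).
exists (c * 3 ^ d)%N, (2 ^ (K0 + E0 + 1))%N => n k nn kl.
have n0 : (0 < n)%N by apply: leq_trans nn; rewrite expn_gt0.
set l := trunc_log 2 n in kl *.
have ll : (K0 + E0 + 1 <= l)%N by exact: trunc_log_max.
set K := (k %/ 3 ^ d)%N.
have d30 : (0 < 3 ^ d)%N by rewrite expn_gt0.
have Kl : (c * l <= K)%N.
  by rewrite /K leq_divRL//; apply: ltnW; rewrite mulnAC.
have lK : (l <= K)%N by apply: leq_trans Kl; rewrite leq_pmull.
have TK : T%:R <= eta * K%:R.
  rewrite mulrC -ler_pdivrMr//; apply: ltW; apply: (lt_le_trans (archi_boundP _)).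
    by rewrite divr_ge0// ltW.
  by rewrite ler_nat; apply: leq_trans lK; apply: leq_trans ll; rewrite -addnA leq_addr.
have k0 : (0 < k)%N by apply: leq_ltn_trans kl.
have := pr_Cmax_eq_le d2 p01 pa a1 HP n k0 (ltn0Sn _ : (0 < T)%N) TK rT.
move=> /le_trans; apply; rewrite [leRHS](splitr eps) lerD//.
have box2 : (#|` @boxf d n| <= 2 ^ (2 * d) * (2 ^ l) ^ d)%N.
  rewrite card_boxf expnM -expnMn leq_exp2r ?(ltnW d2)//.
  have := trunc_log_ltn n (isT : (1 < 2)%N); rewrite -/l expnS.
  by move: (2 ^ l)%N; clear; lia.
have ZK : Z ^+ K <= (2^-1) ^+ (d.+1 * l).
  apply: (@le_trans _ _ (Z ^+ (c * l))).
    by apply: ler_wiXn2l => //; exact: ltW.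
  rewrite !exprM; apply: lerXn2r => //; rewrite nnegrE exprn_ge0//; first exact: ltW.
apply: (@le_trans _ _ ((2 ^ (2 * d) * (2 ^ l) ^ d)%:R * (2^-1) ^+ (d.+1 * l))).
  apply: ler_pM => //; first by rewrite exprn_ge0// ltW.
  by rewrite ler_nat.
rewrite natrM !natrX [(d.+1 * l)%N]mulSn [2^-1 ^+ _]exprD -!exprM [(d * l)%N]mulnC.
have -> : 2 ^+ (2 * d) * 2 ^+ (l * d) * (2^-1 ^+ l * 2^-1 ^+ (l * d)) =
   4 ^+ d * 2^-1 ^+ l * (2 * 2^-1) ^+ (l * d) :> R.
  rewrite exprMn exprM (_ : 2 ^+ 2 = 4); last by rewrite -natrX.
  move: (2 ^+ (l * d)) (4 ^+ d) (2^-1 ^+ l) (2^-1 ^+ (l * d)) => x y z t.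
  by ring.
rewrite divff// expr1n mulr1 exprVn ler_pdivrMr ?exprn_gt0//.
have h : 4 ^+ d * 2 / eps < E0%:R.
  by apply: archi_boundP; rewrite divr_ge0 ?mulr_ge0 ?exprn_ge0// ltW.
have h2 : E0%:R <= 2 ^+ l :> R.
  rewrite -natrX ler_nat; apply: (@leq_trans l); last exact/ltnW/ltn_expl.
  by apply: leq_trans ll; rewrite addn1 leqW// leq_addl.
have := lt_le_trans h h2; rewrite ltr_pdivrMr// => /ltW.
by rewrite mulrAC [eps * _]mulrC => ?; rewrite ler_pdivlMr.
Qed.

Hypothesis theta_gt0 :
  0 < pr P [set w : 'rV[int]_d -> bool | infinite_set (cluster w 0)].

Lemma exists_quantile n (q : R) : q < 1 ->
  exists k, q <= pr P [set w | (Cmax n w <= k)%N].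
Proof.
move=> q1; apply: contrapT => nex.
have lt k : pr P [set w | (Cmax n w <= k)%N] <= q.
  by rewrite leNgt; apply/negP => h; apply: nex; exists k; exact: ltW.
have : pr P (\bigcup_k [set w : 'rV[int]_d -> bool | (Cmax n w <= k)%N]) <= q.
  apply: pr_bigcup_le => // k; first exact: measurable_Cmax_le.
  by move=> w /= /leq_trans; apply.
rewrite (_ : \bigcup_k _ = setT); first by rewrite /pr probability_setT /= leNgt q1.
by apply/seteqP; split => // w _; exists (Cmax n w) => /=.
Qed.

Definition quantile n (q : R) (q1 : q < 1) : nat := ex_minn (exists_quantile n q1).

Lemma quantile_large (q : R) (q1 : q < 1) (M : nat) : 0 < q -> exists n0, forall n,
  (n0 <= n)%N -> (M * trunc_log 2 n < quantile n q1)%N.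
Proof.
move=> q0; have [n0 h] :=
  pr_Cmax_log_small d2 p01 HP theta_gt0 M (divr_gt0 q0 (ltr0n _ 2)).
exists n0 => n /h {}h; rewrite ltnNge; apply/negP => le; move: le.
rewrite /quantile; case: ex_minnP => k qk _ kM.
have : pr P [set w | (Cmax n w <= k)%N] <=
    pr P [set w | (Cmax n w <= M * trunc_log 2 n)%N].
  apply: le_pr; [exact: measurable_Cmax_le|exact: measurable_Cmax_le|].
  by move=> w /= /leq_trans; apply.
by have := divr_gt0 q0 (ltr0n R 2); lra.
Qed.

(** By minimality the probability of being at most the predecessor of the
    quantile is below [q]. *)
Lemma pr_quantile n (q : R) (q1 : q < 1) : (0 < quantile n q1)%N ->
  q <= pr P [set w | (Cmax n w <= quantile n q1)%N] <=
  q + pr P [set w | Cmax n w = quantile n q1].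
Proof.
rewrite /quantile; case: ex_minnP => k qk mink k0; rewrite qk /=.
have lt : pr P [set w | (Cmax n w <= k.-1)%N] < q.
  by rewrite ltNge; apply/negP => /mink; move: k0; clear; lia.
apply: (@le_trans _ _
  (pr P [set w | (Cmax n w <= k.-1)%N] + pr P [set w | Cmax n w = k])).
  apply: le_trans (pr_setU_le _ _ _).
  - apply: le_pr; first exact: measurable_Cmax_le.
      apply: measurableU; first exact: measurable_Cmax_le.
      exact: measurable_Cmax_eq.
    move=> w /=; rewrite leq_eqVlt => /orP[/eqP|h]; first by right.
    by left; move: h; clear; lia.
  - exact: measurable_Cmax_le.
  - exact: measurable_Cmax_eq.
by rewrite lerD2r ltW.
Qed.

Lemma quantile_cvg (q : R) (q1 : q < 1) : 0 < q ->
  P [set w : 'rV[int]_d -> bool | (Cmax n w <= quantile n q1)%N] @[n --> \oo] --> q%:E.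
Proof.
move=> q0.
have -> : (fun n => P [set w : 'rV[int]_d -> bool | (Cmax n w <= quantile n q1)%N]) =
    EFin \o (fun n => pr P [set w | (Cmax n w <= quantile n q1)%N]).
  by apply/funext => n; rewrite prE//; exact: measurable_Cmax_le.
apply: cvg_EFin; first by apply: nearW.
apply/cvgrPdist_le => eps eps0.
have [M [n1 atom]] := pr_Cmax_atom_small eps0.
have [n2 large] := quantile_large q1 M q0.
exists (maxn n1 n2) => // n /=; rewrite geq_max => /andP[nn1 nn2].
have k0 : (0 < quantile n q1)%N by exact: leq_ltn_trans (large n nn2).
have /andP[h1 h2] := pr_quantile k0.
have := atom n _ nn1 (large n nn2).
by rewrite ler_norml; lra.
Qed.

Lemma quantile_cvgny (q : R) (q1 : q < 1) : 0 < q ->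
  quantile n q1 @[n --> \oo] --> \oo.
Proof.
move=> q0; apply/cvgnyPge => A.
have [n0 large] := quantile_large q1 1 q0.
exists (maxn n0 (2 ^ A)) => // n /=; rewrite geq_max => /andP[nn1 nn2].
apply: leq_trans (ltnW (large n nn1)); rewrite mul1n.
by apply: trunc_log_max.
Qed.

End assembly.

(** At [p = 0] there is no infinite cluster, so the set defining the critical
    probability is not empty and its supremum is a nonnegative upper bound. *)
Lemma supercritical (d : nat) (R : realType) (p : R) :
  critical_probability d R < p -> p < 1 ->
  0 < p /\ 0 < pr (percolation_measure d p)
     [set w : 'rV[int]_d -> bool | infinite_set (cluster w 0)].
Proof.
rewrite /critical_probability; set S := [set p | _] => Sp p1.
have ub : ubound S 1 by move=> r [/andP[]].
have S0 : S 0.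
  split; first by rewrite lexx ler01.
  have H := @percolation_measureP d R 0; rewrite lexx ler01 in H.
  have H0 : percolation_measure d (0 : R) (cylinder [fset 0]%fset (fun=> true)) = 0%E.
    by rewrite [LHS](H isT) big_seq_fset1.
  apply/eqP; rewrite eq_le measure_ge0 andbT -H0.
  apply: le_measure; rewrite ?inE.
  - exact: measurable_infinite_cluster.
  - exact: (@measurable_cylinder (site d) [fset 0]%fset (fun=> true)).
  - move=> w /= inf x /fset1P ->; apply/negPn/negP => w0; apply: inf.
    by rewrite cluster_vacant.
have hs : has_sup S by split; [exists 0|exists 1].
have p0 : 0 < p by apply: le_lt_trans Sp; exact: sup_upper_bound.
split => //; rewrite lt_neqAle pr_ge0 andbT; apply/eqP => e.
have : S p.
  split; first by rewrite (ltW p0) (ltW p1).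
  by rewrite (prE _ (@measurable_infinite_cluster d 0)) -e.
by move=> /(sup_upper_bound hs); rewrite leNgt Sp.
Qed.

Theorem theorem1p16 (R : realType) (d : nat) (p : R) :
  (2 <= d)%N -> critical_probability d R < p -> p < 1 ->
  exists u : nat -> R -> nat,
    (forall x : R, u n x @[n --> \oo] --> \oo) /\
    (forall x : R,
      percolation_measure d p
        [set w : 'rV[int]_d -> bool | (Cmax n w <= u n x)%N] @[n --> \oo]
      --> (expR (- expR (- x)))%:E).
Proof.
move=> d2 pc p1; have [p0 theta0] := supercritical pc p1.
have p01 : 0 < p < 1 by rewrite p0.
have HP : is_bernoulli_product p (percolation_measure d p).
  by apply: percolation_measureP; rewrite !ltW.
have q1 x : expR (- expR (- x)) < 1 :> R by rewrite expR_lt1 oppr_lt0 expR_gt0.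
exists (fun n x => quantile (percolation_measure d p) n (q1 x)); split => x.
- exact: (quantile_cvgny d2 p01 HP theta0 (q1 x) (expR_gt0 _)).
- exact: (quantile_cvg d2 p01 HP theta0 (q1 x) (expR_gt0 _)).
Qed.
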